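(* Let $\Omega\subset\mathbb{H}$ be a circular slice domain and let $f\in\mathcal{R}(\Omega)$ be such that $f_v$ has a non-real isolated zero. Then $-\exp_*(f)$ has no $*$-logarithm, i.e. there is no $h\in\mathcal{R}(\Omega)$ with $\exp_*(h)=-\exp_*(f)$.
   Context: $\mathbb{H}$ is the algebra of quaternions; $q=q_0+q_v$ with $q_0$ real and $q_v$ purely imaginary, $q^c=q_0-q_v$, $\mathbb{S}=\{I\in\mathbb{H}: I^2=-1\}$, $\mathbb{C}_I=\mathbb{R}+\mathbb{R}I$, $\mathbb{S}_q=\{q_0+\|q_v\|J: J\in\mathbb{S}\}$, $\Omega_I=\Omega\cap\mathbb{C}_I$. A domain (nonempty connected open set) $\Omega\subset\mathbb{H}$ is circular if $\mathbb{S}_q\subset\Omega$ for all $q\in\Omega$; it is a slice domain if $\Omega\cap\mathbb{R}\neq\emptyset$. A function $f:\Omega\to\mathbb{H}$ is slice regular if $f(\alpha+I\beta)=F_0(\alpha+\sqrt{-1}\beta)+I F_1(\alpha+\sqrt{-1}\beta)$ for all $I\in\mathbb{S}$ and $\alpha,\beta\in\mathbb{R}$ with $\alpha+I\beta\in\Omega$, where $F_0,F_1:\{\alpha+\sqrt{-1}\beta:\alpha+I\beta\in\Omega\}\to\mathbb{H}$ are $C^1$, $F_0(\bar z)=F_0(z)$, $F_1(\bar z)=-F_1(z)$ and $\partial_\alpha F_0=\partial_\beta F_1$, $\partial_\beta F_0=-\partial_\alpha F_1$. $\mathcal{R}(\Omega)$ is the set of slice regular functions; $f\in\mathcal{R}(\Omega)$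 is slice preserving if $f(\Omega_I)\subset\mathbb{C}_I$ for all $I\in\mathbb{S}$, and $\mathcal{R}_{\mathbb{R}}(\Omega)$ is the set of slice preserving functions. The $*$-product is $(f*g)(q)=0$ if $f(q)=0$, and $(f*g)(q)=f(q)\,g(f(q)^{-1}qf(q))$ otherwise; with pointwise sum it makes $\mathcal{R}(\Omega)$ an associative algebra. The slice conjugate $f^c$ is the function induced by $(F_0^c,F_1^c)$ (pointwise conjugates), and $f^s=f*f^c$. Every $f\in\mathcal{R}(\Omega)$ is uniquely $f=f_0+f_1i+f_2j+f_3k$ with $f_\ell\in\mathcal{R}_{\mathbb{R}}(\Omega)$; $f_0$ is its real part and $f_v=f-f_0$ its vector part. $\exp_*(f)=\sum_{n\ge0}f^{*n}/n!$, with $f^{*n}$ the $n$-th $*$-power. Non-real isolated zeroes: let $f\in\mathcal{R}(\Omega)$ with $f^s\not\equiv0$ and $q_0\in\Omega\setminus\mathbb{R}$. Write $f=\Delta^m\tilde f$ with $m\ge0$ the largest integer for which this is possible with $\tilde f\in\mathcal{R}(\Omega)$, where $\Delta(q)=q^2-2q\,\mathrm{Re}(q_0)+|q_0|^2$ (so $\tilde f\not\equiv0$ on $\mathbb{S}_{q_0}$). The point $q_0$ is a non-real isolated zero of $f$ if $\tilde f(q_0)=0$. If $f^s\equiv0$, $f$ has no non-real isolated zeroes. *)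

(* Defs.v *)
From Stdlib Require Import Reals Factorial.
From Coquelicot Require Import Coquelicot.
Open Scope R_scope.

(** Quaternions [((q0, q1), q2), q3] stand for [q0 + q1 i + q2 j + q3 k].  As an
    iterated product, the type inherits from Coquelicot its real normed module
    structure, whose norm is the Euclidean one; [open], [continuous] and
    [is_derive] below refer to it. *)
Definition quat : Type := (R * R * R * R)%type.

Definition mkq (a b c d : R) : quat := (a, b, c, d).
Definition q_re (q : quat) : R := fst (fst (fst q)).
Definition q_i (q : quat) : R := snd (fst (fst q)).
Definition q_j (q : quat) : R := snd (fst q).
Definition q_k (q : quat) : R := snd q.

Definition qreal (a : R) : quat := mkq a 0 0 0.
Definition qi : quat := mkq 0 1 0 0.
Definition qj : quat := mkq 0 0 1 0.
Definition qk : quat := mkq 0 0 0 1.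

Definition qadd (p q : quat) : quat := plus p q.
Definition qopp (p : quat) : quat := opp p.
Definition qscal (a : R) (p : quat) : quat := scal a p.
Definition qmul (p q : quat) : quat :=
  mkq (q_re p * q_re q - q_i p * q_i q - q_j p * q_j q - q_k p * q_k q)
      (q_re p * q_i q + q_i p * q_re q + q_j p * q_k q - q_k p * q_j q)
      (q_re p * q_j q - q_i p * q_k q + q_j p * q_re q + q_k p * q_i q)
      (q_re p * q_k q + q_i p * q_j q - q_j p * q_i q + q_k p * q_re q).

Declare Scope quat_scope.
Delimit Scope quat_scope with Q.
Bind Scope quat_scope with quat.
Notation "p + q" := (qadd p q) : quat_scope.
Notation "- p" := (qopp p) : quat_scope.
Notation "p - q" := (qadd p (qopp q)) : quat_scope.
Notation "p * q" := (qmul p q) : quat_scope.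

Definition qconj (q : quat) : quat := mkq (q_re q) (- q_i q) (- q_j q) (- q_k q).
Definition qvec (q : quat) : quat := mkq 0 (q_i q) (q_j q) (q_k q).
Definition qnorm2 (q : quat) : R :=
  q_re q ^ 2 + q_i q ^ 2 + q_j q ^ 2 + q_k q ^ 2.
Definition qnorm (q : quat) : R := sqrt (qnorm2 q).
Definition qinv (q : quat) : quat := qscal (/ qnorm2 q) (qconj q).

Fixpoint qpow (q : quat) (n : nat) : quat :=
  match n with
  | O => qreal 1
  | S n => (q * qpow q n)%Q
  end.

Definition quat_eq_dec (p q : quat) : {p = q} + {p <> q}.
Proof. repeat decide equality; apply Req_EM_T. Defined.

Definition imag_unit (I : quat) : Prop := (I * I)%Q = qreal (-1).

Definition slice_pt (I : quat) (a b : R) : quat := (qreal a + I * qreal b)%Q.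

Definition in_slice (I q : quat) : Prop := exists a b : R, q = slice_pt I a b.

Definition is_real (q : quat) : Prop := exists a : R, q = qreal a.

Definition sphere (q p : quat) : Prop :=
  exists J : quat, imag_unit J /\ p = slice_pt J (q_re q) (qnorm (qvec q)).

Definition connected (A : quat -> Prop) : Prop :=
  forall U V : quat -> Prop,
    open U -> open V ->
    (forall q, A q -> U q \/ V q) ->
    (exists q, A q /\ U q) -> (exists q, A q /\ V q) ->
    exists q, A q /\ U q /\ V q.

Definition domain (Omega : quat -> Prop) : Prop :=
  (exists q, Omega q) /\ connected Omega /\ open Omega.

Definition circular (Omega : quat -> Prop) : Prop :=
  forall q p, Omega q -> sphere q p -> Omega p.

Definition circular_slice_domain (Omega : quat -> Prop) : Prop :=
  domain Omega /\ circular Omega /\ (exists q, Omega q /\ is_real q).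

(** The planar domain of the stem functions, with [(a, b)] standing for
    [a + sqrt(-1) b]. *)
Definition stem_dom (Omega : quat -> Prop) (z : R * R) : Prop :=
  exists I : quat, imag_unit I /\ Omega (slice_pt I (fst z) (snd z)).

(** [F] is C^1 on [D], with partial derivatives [Fa] and [Fb] there. *)
Definition C1_on (D : R * R -> Prop) (F Fa Fb : R * R -> quat) : Prop :=
  forall a b : R, D (a, b) ->
    is_derive (fun x : R => F (x, b)) a (Fa (a, b)) /\
    is_derive (fun y : R => F (a, y)) b (Fb (a, b)) /\
    continuous Fa (a, b) /\
    continuous Fb (a, b).

Definition holomorphic_stem (Omega : quat -> Prop) (F0 F1 : R * R -> quat) : Prop :=
  (forall a b, stem_dom Omega (a, b) ->
     F0 (a, - b) = F0 (a, b) /\ F1 (a, - b) = (- F1 (a, b))%Q) /\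
  exists F0a F0b F1a F1b : R * R -> quat,
    C1_on (stem_dom Omega) F0 F0a F0b /\
    C1_on (stem_dom Omega) F1 F1a F1b /\
    (forall z, stem_dom Omega z -> F0a z = F1b z /\ F0b z = (- F1a z)%Q).

Definition induced (Omega : quat -> Prop) (F0 F1 : R * R -> quat)
    (f : quat -> quat) : Prop :=
  forall I a b, imag_unit I -> Omega (slice_pt I a b) ->
    f (slice_pt I a b) = (F0 (a, b) + I * F1 (a, b))%Q.

(** Slice functions on [Omega] are total functions on [quat] of which only the
    values on [Omega] are relevant. *)
Definition slice_regular (Omega : quat -> Prop) (f : quat -> quat) : Prop :=
  exists F0 F1, holomorphic_stem Omega F0 F1 /\ induced Omega F0 F1 f.

Definition slice_preserving (Omega : quat -> Prop) (f : quat -> quat) : Prop :=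
  slice_regular Omega f /\
  forall I q, imag_unit I -> Omega q -> in_slice I q -> in_slice I (f q).

Definition slice_conj (Omega : quat -> Prop) (f fc : quat -> quat) : Prop :=
  exists F0 F1, holomorphic_stem Omega F0 F1 /\ induced Omega F0 F1 f /\
    induced Omega (fun z => qconj (F0 z)) (fun z => qconj (F1 z)) fc.

(** The point [f(q)^-1 q f(q)] lies in [sphere q], so on a circular set the
    values of [star f g] depend only on those of [f] and [g] on that set. *)
Definition star (f g : quat -> quat) (q : quat) : quat :=
  if quat_eq_dec (f q) (qreal 0) then qreal 0
  else (f q * g (qinv (f q) * q * f q))%Q.

Fixpoint star_pow (f : quat -> quat) (n : nat) : quat -> quat :=
  match n with
  | O => fun _ => qreal 1
  | S n => star f (star_pow f n)
  end.

Definition qSeries (a : nat -> quat) : quat :=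
  mkq (Series (fun n => q_re (a n))) (Series (fun n => q_i (a n)))
      (Series (fun n => q_j (a n))) (Series (fun n => q_k (a n))).

Definition exp_star (f : quat -> quat) (q : quat) : quat :=
  qSeries (fun n => qscal (/ INR (fact n)) (star_pow f n q)).

Definition real_part (Omega : quat -> Prop) (f f0 : quat -> quat) : Prop :=
  exists f1 f2 f3 : quat -> quat,
    slice_preserving Omega f0 /\ slice_preserving Omega f1 /\
    slice_preserving Omega f2 /\ slice_preserving Omega f3 /\
    forall q, Omega q -> f q = (f0 q + f1 q * qi + f2 q * qj + f3 q * qk)%Q.

Definition vector_part (Omega : quat -> Prop) (f fv : quat -> quat) : Prop :=
  exists f0, real_part Omega f f0 /\
    forall q, Omega q -> fv q = (f q - f0 q)%Q.

Definition Delta (q0 q : quat) : quat :=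
  (q * q - qscal (2 * q_re q0) q + qreal (qnorm2 q0))%Q.

(** [Delta q0] is slice preserving, so the product below is also the
    star-product of [g] by the [m]-th star-power of [Delta q0]. *)
Definition Delta_factor (Omega : quat -> Prop) (q0 : quat) (f : quat -> quat)
    (m : nat) (g : quat -> quat) : Prop :=
  slice_regular Omega g /\
  forall q, Omega q -> f q = (qpow (Delta q0 q) m * g q)%Q.

Definition symmetrization_nonzero (Omega : quat -> Prop) (f : quat -> quat) : Prop :=
  exists fc, slice_conj Omega f fc /\
    exists q, Omega q /\ star f fc q <> qreal 0.

Definition nonreal_isolated_zero (Omega : quat -> Prop) (f : quat -> quat)
    (q0 : quat) : Prop :=
  Omega q0 /\ ~ is_real q0 /\ symmetrization_nonzero Omega f /\
  exists (m : nat) (g : quat -> quat),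
    Delta_factor Omega q0 f m g /\
    (forall m' g', Delta_factor Omega q0 f m' g' -> (m' <= m)%nat) /\
    g q0 = qreal 0.

(* Main.v *)
Require Import Defs.
From Stdlib Require Import Reals Factorial Lra Lia Psatz.
From Coquelicot Require Import Coquelicot.
Open Scope R_scope.

(** A slice regular function [f] is determined by its stem, a holomorphic function with
    values in the quaternions with complex coefficients; the star product is the pointwise
    product of stems, and the stem of [exp_star f] is the exponential of the stem of [f].
    Write the stem of [f] as [x + V] with [x] a complex function and [V] a vector with
    complex coefficients.  Since [V * V = - n] for [n] the sum of the squares of these
    coefficients, [exp (x + V) = exp x * (c + s V)] with [c] and [s] the cosine and the
    cardinal sine of a square root of [n]; in particular [c * c + n * (s * s) = 1]
    ([pow_coef_series], [exp_star_slice]).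

    Suppose [exp_star h = - exp_star f], with the stem of [h] written as [y + W], and with
    [n'], [c'], [s'] for [h].  Comparing complex norms gives [exp (2 y) = exp (2 x)].  On the
    real axis [x] and [y] are real, hence equal, and by connectedness [y = x] everywhere
    ([exp_star_opp_real_part]).  So [c' = - c] and [s' W = - s V].

    Let [q0] be a non-real isolated zero of the vector part of [f], which is
    [Delta^m * g] with [g q0 = 0], and let [z0] be the point of the stem domain below
    [q0].  The stem [G] of [g] is isotropic at [z0]: its sum of squares vanishes there
    ([isotropic_of_zero]), hence so does [n].  Therefore [c = 1] and [c' = -1] at [z0], so
    that [n' z0] is nonzero.  Near [z0] the cardinal sine [s] is nonzero and [V] is a
    complex multiple of [W], so [n' * V_l^2 = n * W_l^2] for each component [l].  After
    cancelling [Delta^(2 m)] this becomes [n' * G_l^2 = W_l^2 * (sum of squares of G)], and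
    at [z0] it gives [G_l z0 = 0].  So [G], and not only its value on one slice, vanishes at
    [z0], and can be divided by [Delta] once more, against the maximality of [m].

    That last division is the analytic part: the quotient of a holomorphic function of
    class C^1 by a linear factor vanishing with it is again of class C^1 ([hol_divide]).
    It is derived from Cauchy's formula on a circle, which is proved by contracting
    the circle to a point ([cauchy_formula]), and from the holomorphy of Cauchy integrals
    of continuous densities ([Cderiv_cauchy_integral]). *)

(** * Continuity of complex-valued functions *)

Lemma continuous_C_pair {U : UniformSpace} (f : U -> C) (x : U) :
  continuous (fun y => Re (f y)) x -> continuous (fun y => Im (f y)) x ->
  continuous f x.
Proof.
  intros H1 H2.
  apply (continuous_ext (fun y => (Re (f y), Im (f y)))).
  - intros y; destruct (f y); reflexivity.
  - apply (continuous_comp_2 (V := R_UniformSpace) (W := R_UniformSpace)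
             (X := C_UniformSpace) _ _ (fun a b : R => (a, b)) x H1 H2).
    intros P HP.
    destruct HP as [e He]. exists e. intros [u v] Huv. apply He. exact Huv.
Qed.

Lemma continuous_Re {U : UniformSpace} (f : U -> C) (x : U) :
  continuous f x -> continuous (fun y => Re (f y)) x.
Proof.
  intros H. apply (continuous_comp f (fun z : C => fst z)); [exact H|].
  destruct (f x) as [a b]. apply (continuous_fst (U := R_UniformSpace)).
Qed.

Lemma continuous_Im {U : UniformSpace} (f : U -> C) (x : U) :
  continuous f x -> continuous (fun y => Im (f y)) x.
Proof.
  intros H. apply (continuous_comp f (fun z : C => snd z)); [exact H|].
  destruct (f x) as [a b]. apply (continuous_snd (U := R_UniformSpace)).
Qed.

Lemma continuous_Rmult {U : UniformSpace} (f g : U -> R) (x : U) :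
  continuous f x -> continuous g x -> continuous (fun y => f y * g y) x.
Proof. intros; apply (continuous_mult (K := R_AbsRing)); assumption. Qed.

Lemma continuous_Rplus {U : UniformSpace} (f g : U -> R) (x : U) :
  continuous f x -> continuous g x -> continuous (fun y => f y + g y) x.
Proof. intros; apply (continuous_plus (V := R_NormedModule)); assumption. Qed.

Lemma continuous_Ropp {U : UniformSpace} (f : U -> R) (x : U) :
  continuous f x -> continuous (fun y => - f y) x.
Proof. intros; apply (continuous_opp (V := R_NormedModule)); assumption. Qed.

Lemma continuous_Rinv {U : UniformSpace} (f : U -> R) (x : U) :
  continuous f x -> f x <> 0 -> continuous (fun y => / f y) x.
Proof.
  intros H H0. apply (continuous_comp f Rinv); [exact H|].
  apply continuity_pt_filterlim, continuity_pt_inv; [|exact H0].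
  apply continuity_pt_filterlim, continuous_id.
Qed.

Lemma continuous_Cplus {U : UniformSpace} (f g : U -> C) (x : U) :
  continuous f x -> continuous g x -> continuous (fun y => f y + g y)%C x.
Proof.
  intros Hf Hg. apply continuous_C_pair.
  - exact (continuous_Rplus _ _ x (continuous_Re f x Hf) (continuous_Re g x Hg)).
  - exact (continuous_Rplus _ _ x (continuous_Im f x Hf) (continuous_Im g x Hg)).
Qed.

Lemma continuous_Copp {U : UniformSpace} (f : U -> C) (x : U) :
  continuous f x -> continuous (fun y => - f y)%C x.
Proof.
  intros Hf. apply continuous_C_pair.
  - exact (continuous_Ropp _ x (continuous_Re f x Hf)).
  - exact (continuous_Ropp _ x (continuous_Im f x Hf)).
Qed.

Lemma continuous_Cminus {U : UniformSpace} (f g : U -> C) (x : U) :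
  continuous f x -> continuous g x -> continuous (fun y => f y - g y)%C x.
Proof.
  intros Hf Hg. apply continuous_Cplus; [|apply continuous_Copp]; assumption.
Qed.

Lemma continuous_Cmult {U : UniformSpace} (f g : U -> C) (x : U) :
  continuous f x -> continuous g x -> continuous (fun y => f y * g y)%C x.
Proof.
  intros Hf Hg.
  pose proof (continuous_Re f x Hf). pose proof (continuous_Im f x Hf).
  pose proof (continuous_Re g x Hg). pose proof (continuous_Im g x Hg).
  apply continuous_C_pair.
  - exact (continuous_Rplus _ _ x (continuous_Rmult _ _ x H H1)
             (continuous_Ropp _ x (continuous_Rmult _ _ x H0 H2))).
  - exact (continuous_Rplus _ _ x (continuous_Rmult _ _ x H H2)
             (continuous_Rmult _ _ x H0 H1)).
Qed.

Lemma continuous_Cinv {U : UniformSpace} (f : U -> C) (x : U) :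
  continuous f x -> f x <> 0 -> continuous (fun y => / f y)%C x.
Proof.
  intros Hf Hnz.
  pose proof (continuous_Re f x Hf). pose proof (continuous_Im f x Hf).
  assert (Hn : fst (f x) ^ 2 + snd (f x) ^ 2 <> 0).
  { intros E. apply Hnz. destruct (f x) as [a b]; simpl in E.
    apply injective_projections; simpl; nra. }
  assert (Hd : continuous (fun y => fst (f y) ^ 2 + snd (f y) ^ 2) x).
  { pose proof (continuous_const (V := R_UniformSpace) 1 x) as H1.
    exact (continuous_Rplus _ _ x
      (continuous_Rmult _ _ x H (continuous_Rmult _ _ x H H1))
      (continuous_Rmult _ _ x H0 (continuous_Rmult _ _ x H0 H1))). }
  apply continuous_Rinv in Hd; [|exact Hn].
  apply continuous_C_pair.
  - exact (continuous_Rmult _ _ x H Hd).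
  - exact (continuous_Rmult _ _ x (continuous_Ropp _ x H0) Hd).
Qed.

Lemma continuous_Cconj {U : UniformSpace} (f : U -> C) (x : U) :
  continuous f x -> continuous (fun y => Cconj (f y)) x.
Proof.
  intros Hf. apply continuous_C_pair.
  - exact (continuous_Re f x Hf).
  - exact (continuous_Ropp _ x (continuous_Im f x Hf)).
Qed.

Lemma continuous_Cpow {U : UniformSpace} (f : U -> C) (n : nat) (x : U) :
  continuous f x -> continuous (fun y => f y ^ n)%C x.
Proof.
  intros Hf. induction n; simpl.
  - apply continuous_const.
  - apply continuous_Cmult; assumption.
Qed.

(* An equality stated at a carrier such as [UniformSpace.sort _] hides its ring from
   [ring] and [field]. *)
Ltac toR := lazymatch goal with |- @eq _ ?x ?y => change (@eq R x y) end.
Ltac toC := lazymatch goal with |- @eq _ ?x ?y => change (@eq C x y) end.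

Ltac ccont := repeat lazymatch goal with
  | H : continuous ?f ?x |- continuous ?f ?x => exact H
  | H : continuous ?f ?x |- continuous (fun y => ?f y) ?x => exact H
  | |- continuous (fun _ => ?c) _ => apply continuous_const
  | |- continuous (fun y => y) _ => apply continuous_id
  | |- continuous (fun y => Cminus (@?f y) (@?g y)) ?x =>
      apply (continuous_Cminus f g x)
  | |- continuous (fun y => Cplus (@?f y) (@?g y)) ?x =>
      apply (continuous_Cplus f g x)
  | |- continuous (fun y => Copp (@?f y)) ?x => apply (continuous_Copp f x)
  | |- continuous (fun y => Cmult (@?f y) (@?g y)) ?x =>
      apply (continuous_Cmult f g x)
  | |- continuous (fun y => Cpow (@?f y) ?n) ?x => apply (continuous_Cpow f n x)
  | |- continuous (fun y => Cconj (@?f y)) ?x => apply (continuous_Cconj f x)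
  | _ => idtac
  end.

(** The uniform structure of [C] is the product one, with squares as balls; the
    comparison of the two norms turns its neighbourhoods into round discs. *)
Lemma locally_disc (z : C) (P : C -> Prop) :
  locally z P <-> exists d : R, 0 < d /\ forall w, Cmod (w - z) < d -> P w.
Proof.
  split.
  - intros [e He]. exists e. split; [apply cond_pos|]. intros w Hw. apply He.
    pose proof (Rmax_Cmod (w - z)%C) as Hm. simpl in Hm.
    split; unfold ball; simpl; unfold AbsRing_ball, abs, minus, plus, opp; simpl;
    [apply Rle_lt_trans with (2 := Hw), Rle_trans with (2 := Hm), Rmax_l
    |apply Rle_lt_trans with (2 := Hw), Rle_trans with (2 := Hm), Rmax_r].
  - intros (d & Hd & H).
    assert (Hd2 : 0 < d / 2) by lra.
    exists (mkposreal _ Hd2). intros w [H1 H2]. apply H.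
    unfold ball in H1, H2; simpl in H1, H2;
    unfold AbsRing_ball, abs, minus, plus, opp in H1, H2; simpl in H1, H2.
    apply Rle_lt_trans with (1 := Cmod_2Rmax _). simpl.
    apply Rlt_trans with (sqrt 2 * (d / 2)).
    + apply Rmult_lt_compat_l; [apply sqrt_lt_R0; lra|].
      apply Rmax_lub_lt; assumption.
    + assert (sqrt 2 < 2); [|nra].
      rewrite <- (sqrt_pow2 2) at 2 by lra. apply sqrt_lt_1; lra.
Qed.

Lemma disc_open (z : C) (r : R) :
  open (fun w : C => Cmod (w - z) < r).
Proof.
  intros w Hw. apply locally_disc. exists (r - Cmod (w - z)). split; [lra|].
  intros v Hv. replace (v - z)%C with ((v - w) + (w - z))%C by ring.
  apply Rle_lt_trans with (1 := Cmod_triangle _ _). lra.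
Qed.

Lemma continuous_disc (f : C -> C) (z : C) :
  continuous f z <-> forall e, 0 < e -> exists d, 0 < d /\
    forall w, Cmod (w - z) < d -> Cmod (f w - f z) < e.
Proof.
  split.
  - intros H e He.
    assert (HP : locally (f z) (fun v : C => Cmod (v - f z) < e)).
    { apply locally_disc. exists e. auto. }
    apply locally_disc. apply (H _ HP).
  - intros H P HP. apply locally_disc in HP. destruct HP as (e & He & HP).
    destruct (H e He) as (d & Hd & Hw). apply locally_disc.
    exists d. split; auto.
Qed.

Lemma locally_neq (f : C -> C) (z c : C) :
  continuous f z -> f z <> c -> locally z (fun w => f w <> c).
Proof.
  intros Hf Hz. assert (Hp : 0 < Cmod (f z - c)).
  { apply Cmod_gt_0. intros E. apply Hz. apply Ceq_minus. exact E. }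
  apply continuous_disc with (e := Cmod (f z - c)) in Hf; [|exact Hp].
  destruct Hf as (d & Hd & H). apply locally_disc. exists d. split; [exact Hd|].
  intros w Hw E. specialize (H w Hw). rewrite E in H.
  rewrite <- Cmod_opp in H. replace (- (c - f z))%C with (f z - c)%C in H by ring.
  lra.
Qed.

(** [z] is not isolated in [C], so a continuous function is determined at [z] by its
    values nearby.  This is how identities obtained by dividing by a function that
    vanishes only at [z] are carried over to [z]. *)
Lemma limit_unique (f g : C -> C) (z : C) :
  continuous f z -> continuous g z ->
  locally z (fun w => w <> z -> f w = g w) -> f z = g z.
Proof.
  intros Hf Hg H.
  destruct (Ceq_dec (f z) (g z)) as [|Hne]; [assumption|exfalso].
  assert (Hc : continuous (fun w => f w - g w)%C z) by ccont.
  assert (Hz : (f z - g z)%C <> 0).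
  { intros E. apply Hne. apply Ceq_minus. exact E. }
  pose proof (filter_and _ _ H (locally_neq _ _ _ Hc Hz)) as HH.
  apply locally_disc in HH. destruct HH as (d & Hd & HH).
  destruct (HH (z + RtoC (d / 2))%C) as [H1 H2].
  - replace (z + RtoC (d / 2) - z)%C with (RtoC (d / 2)) by ring.
    rewrite Cmod_R, Rabs_pos_eq; lra.
  - apply H2. rewrite H1; [ring|]. intros E.
    apply (f_equal fst) in E. simpl in E. lra.
Qed.

(** * Complex derivatives *)

(** Caratheodory's form of differentiability: the difference quotient extends to a
    function [s] continuous at [z].  It turns the product, quotient and chain rules into
    algebraic identities. *)
Definition Cderiv (f : C -> C) (z l : C) : Prop :=
  exists s : C -> C, continuous s z /\ s z = l /\
    locally z (fun w => f w - f z = s w * (w - z))%C.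

(** Holomorphic functions with continuous derivative; continuity is part of the notion
    here because stem functions are required to be of class C^1. *)
Definition hol (D : C -> Prop) (f : C -> C) : Prop :=
  exists f' : C -> C, forall z, D z -> Cderiv f z (f' z) /\ continuous f' z.

Lemma Cderiv_continuous f z l : Cderiv f z l -> continuous f z.
Proof.
  intros (s & Hs & _ & H).
  apply continuous_ext_loc with (g := fun w => (f z + s w * (w - z))%C).
  - revert H. apply filter_imp. intros w Hw. rewrite <- Hw.
    change (f z + (f w - f z) = f w)%C. ring.
  - ccont.
Qed.

Lemma Cderiv_unique f z l l' : Cderiv f z l -> Cderiv f z l' -> l = l'.
Proof.
  intros (s & Hs & <- & H) (s' & Hs' & <- & H').
  apply limit_unique; try assumption.
  generalize (filter_and _ _ H H'). apply filter_imp.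
  intros w [E E'] Hw. rewrite E in E'.
  assert (Hn : (w - z)%C <> 0).
  { intros E0. apply Hw, Ceq_minus, E0. }
  transitivity (s w * (w - z) * / (w - z))%C; [field; exact Hn|].
  rewrite E'. field. exact Hn.
Qed.

Lemma Cderiv_ext_loc f g z l :
  locally z (fun w => f w = g w) -> Cderiv f z l -> Cderiv g z l.
Proof.
  intros E (s & Hs & Hl & H). exists s. split; [|split]; try assumption.
  pose proof (locally_singleton _ _ E) as Ez. simpl in Ez.
  generalize (filter_and _ _ E H). apply filter_imp.
  intros w [<- Hw]. rewrite <- Ez. exact Hw.
Qed.

Lemma Cderiv_mult f g z l m : Cderiv f z l -> Cderiv g z m ->
  Cderiv (fun w => f w * g w)%C z (l * g z + f z * m)%C.
Proof.
  intros Hf Hg. pose proof (Cderiv_continuous _ _ _ Hg) as Cg.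
  destruct Hf as (s & Hs & <- & Ef), Hg as (t & Ht & <- & Eg).
  exists (fun w => s w * g w + f z * t w)%C. split; [ccont|split; [reflexivity|]].
  generalize (filter_and _ _ Ef Eg). apply filter_imp. intros w [E1 E2].
  replace ((s w * g w + f z * t w) * (w - z))%C
    with (s w * (w - z) * g w + f z * (t w * (w - z)))%C by ring.
  rewrite <- E1, <- E2. ring.
Qed.

Lemma Cderiv_inv (f : C -> C) (z l : C) : f z <> 0 -> Cderiv f z l ->
  Cderiv (fun w => / f w)%C z (- l / (f z * f z))%C.
Proof.
  intros Hz Hf. pose proof (Cderiv_continuous _ _ _ Hf) as Cf.
  destruct Hf as (s & Hs & <- & Ef).
  exists (fun w => - s w * / (f w * f z))%C. split; [|split; [reflexivity|]].
  - apply continuous_Cmult; [ccont|]. apply continuous_Cinv; [ccont|].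
    apply Cmult_neq_0; exact Hz.
  - generalize (filter_and _ _ Ef (locally_neq _ _ _ Cf Hz)).
    apply filter_imp. intros w [E Hw].
    replace (- s w * / (f w * f z) * (w - z))%C
      with (- (s w * (w - z)) * / (f w * f z))%C by ring.
    rewrite <- E. field. split; assumption.
Qed.

Lemma hol_mult D f g : hol D f -> hol D g -> hol D (fun w => f w * g w)%C.
Proof.
  intros (f' & Hf) (g' & Hg).
  exists (fun w => f' w * g w + f w * g' w)%C. intros z Hz.
  destruct (Hf z Hz) as [F1 F2], (Hg z Hz) as [G1 G2].
  pose proof (Cderiv_continuous _ _ _ F1). pose proof (Cderiv_continuous _ _ _ G1).
  split; [apply Cderiv_mult; assumption|ccont].
Qed.

Lemma hol_inv (D : C -> Prop) (f : C -> C) :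
  (forall z, D z -> f z <> 0) -> hol D f -> hol D (fun w => / f w)%C.
Proof.
  intros Hnz (f' & Hf). exists (fun w => - f' w / (f w * f w))%C.
  intros z Hz. destruct (Hf z Hz) as [F1 F2]. specialize (Hnz z Hz).
  pose proof (Cderiv_continuous _ _ _ F1).
  split; [apply Cderiv_inv; assumption|].
  apply continuous_Cmult; [ccont|]. apply continuous_Cinv; [ccont|].
  apply Cmult_neq_0; exact Hnz.
Qed.

Lemma hol_subset (D D' : C -> Prop) f :
  (forall z, D' z -> D z) -> hol D f -> hol D' f.
Proof. intros H (f' & Hf). exists f'. auto. Qed.

Lemma hol_continuous (D : C -> Prop) f z : hol D f -> D z -> continuous f z.
Proof.
  intros (f' & Hf) Hz. apply Cderiv_continuous with (f' z), Hf, Hz.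
Qed.

Lemma hol_minus_const D c : hol D (fun w => w - c)%C.
Proof.
  exists (fun _ => RtoC 1). intros z _. split; [|ccont].
  exists (fun _ => RtoC 1). split; [ccont|split; [reflexivity|]].
  apply filter_forall. intros w. ring.
Qed.

Definition curve_deriv (c : R -> C) (t : R) (l : C) : Prop :=
  is_derive (fun s => Re (c s)) t (Re l) /\ is_derive (fun s => Im (c s)) t (Im l).

Lemma is_derive_slope (f : R -> R) (x l : R) :
  is_derive f x l <->
  exists s : R -> R, continuous s x /\ s x = l /\
    forall y, f y - f x = s y * (y - x).
Proof.
  split.
  - intros H.
    exists (fun y => if Req_EM_T y x then l else (f y - f x) / (y - x)).
    split; [|split].
    + apply is_derive_Reals in H. intros P [e He].
      destruct (Req_EM_T x x) as [_|]; [|congruence].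
      destruct (H e (cond_pos e)) as [d Hd]. exists d. intros y Hy.
      apply He. destruct (Req_EM_T y x) as [->|Hne].
      * apply ball_center.
      * assert (Hh : y - x <> 0) by lra.
        specialize (Hd (y - x) Hh Hy).
        rewrite (Rplus_minus x y) in Hd. exact Hd.
    + destruct (Req_EM_T x x); congruence.
    + intros y. destruct (Req_EM_T y x) as [->|Hne]; toR; [ring|field; lra].
  - intros (s & Hs & <- & H). apply is_derive_Reals. intros e He.
    destruct (Hs (fun v => Rabs (v - s x) < e)) as [d Hd].
    { exists (mkposreal e He). intros v Hv. exact Hv. }
    exists d. intros h Hh Hd'.
    replace ((f (x + h) - f x) / h) with (s (x + h)).
    + apply Hd. unfold ball; simpl; unfold AbsRing_ball, abs, minus, plus, opp; simpl.
      change (Rabs (x + h + - x) < d).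
      replace (x + h + - x) with h by ring. exact Hd'.
    + rewrite H. field. exact Hh.
Qed.

(** Chain rule along a curve: multiply the slope function of [f], composed with the
    curve, by the slope function of the curve. *)
Lemma Cderiv_curve (f : C -> C) (c : R -> C) (t : R) (l m : C) :
  Cderiv f (c t) l -> curve_deriv c t m -> curve_deriv (fun u => f (c u)) t (l * m)%C.
Proof.
  intros (s & Hs & <- & E) [H1 H2].
  assert (Hcc : continuous c t).
  { apply continuous_C_pair; apply (ex_derive_continuous (V := R_NormedModule));
    eexists; eassumption. }
  apply is_derive_slope in H1. destruct H1 as (a & Ha & Ea & Ha').
  apply is_derive_slope in H2. destruct H2 as (b & Hb & Eb & Hb').
  assert (Hk : continuous (fun u => s (c u) * (a u, b u))%C t).
  { apply (continuous_Cmult (fun u => s (c u)) (fun u => (a u, b u))).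
    - apply (continuous_comp c s); assumption.
    - apply continuous_C_pair; assumption. }
  assert (EE : locally t (fun u => f (c u) - f (c t)
                 = s (c u) * (a u, b u) * RtoC (u - t))%C).
  { pose proof (Hcc _ E) as E1. unfold filtermap in E1.
    revert E1. apply filter_imp. intros u Eu.
    rewrite Eu. rewrite <- Cmult_assoc. f_equal.
    apply injective_projections; simpl.
    - rewrite Rmult_0_r, Rminus_0_r. apply Ha'.
    - rewrite Rmult_0_r, Rplus_0_l, Rmult_comm, (Rmult_comm (u - t)), <- Hb'.
      unfold Im. ring. }
  assert (Em : m = (a t, b t)).
  { rewrite Ea, Eb. apply surjective_pairing. }
  split.
  - apply is_derive_ext_loc with
      (f := fun u => Re (f (c t)) + Re (s (c u) * (a u, b u))%C * (u - t)).
    + revert EE. apply filter_imp. intros u Eu. apply (f_equal Re) in Eu.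
      change (Re (f (c t)) + Re (s (c u) * (a u, b u))%C * (u - t) = Re (f (c u))).
      transitivity (Re (f (c t)) + Re (s (c u) * (a u, b u) * RtoC (u - t))%C).
      * unfold Re; simpl; ring.
      * rewrite <- Eu. unfold Re; simpl; ring.
    + apply is_derive_slope. exists (fun u => Re (s (c u) * (a u, b u))%C).
      split; [exact (continuous_Re _ _ Hk)|split].
      * rewrite Em; reflexivity.
      * intros y. toR. ring.
  - apply is_derive_ext_loc with
      (f := fun u => Im (f (c t)) + Im (s (c u) * (a u, b u))%C * (u - t)).
    + revert EE. apply filter_imp. intros u Eu. apply (f_equal Im) in Eu.
      change (Im (f (c t)) + Im (s (c u) * (a u, b u))%C * (u - t) = Im (f (c u))).
      transitivity (Im (f (c t)) + Im (s (c u) * (a u, b u) * RtoC (u - t))%C).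
      * unfold Im; simpl; ring.
      * rewrite <- Eu. unfold Im; simpl; ring.
    + apply is_derive_slope. exists (fun u => Im (s (c u) * (a u, b u))%C).
      split; [exact (continuous_Im _ _ Hk)|split].
      * rewrite Em; reflexivity.
      * intros y. toR. ring.
Qed.

Lemma curve_deriv_mult_const (c : R -> C) (t : R) (l k : C) :
  curve_deriv c t l -> curve_deriv (fun u => c u * k)%C t (l * k)%C.
Proof.
  intros H.
  assert (Hk : Cderiv (fun z => z * k)%C (c t) k).
  { exists (fun _ => k). split; [ccont|split; [reflexivity|]].
    apply filter_forall. intros w. ring. }
  rewrite Cmult_comm. exact (Cderiv_curve _ c t k l Hk H).
Qed.

(** * Integrals of complex-valued functions of a real variable *)

Definition CInt (f : R -> C) (a b : R) : C :=
  (RInt (fun t => Re (f t)) a b, RInt (fun t => Im (f t)) a b).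

Lemma ex_RInt_Re (f : R -> C) a b :
  (forall t, continuous f t) -> ex_RInt (fun t => Re (f t)) a b.
Proof.
  intros H. apply (ex_RInt_continuous (V := R_CompleteNormedModule)).
  intros t _. apply continuous_Re, H.
Qed.

Lemma ex_RInt_Im (f : R -> C) a b :
  (forall t, continuous f t) -> ex_RInt (fun t => Im (f t)) a b.
Proof.
  intros H. apply (ex_RInt_continuous (V := R_CompleteNormedModule)).
  intros t _. apply continuous_Im, H.
Qed.

Lemma CInt_ext (f g : R -> C) a b :
  (forall t, f t = g t) -> CInt f a b = CInt g a b.
Proof.
  intros H. unfold CInt. f_equal; apply RInt_ext; intros t _; rewrite H; reflexivity.
Qed.

Lemma CInt_plus (f g : R -> C) a b :
  (forall t, continuous f t) -> (forall t, continuous g t) ->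
  CInt (fun t => f t + g t)%C a b = (CInt f a b + CInt g a b)%C.
Proof.
  intros Hf Hg.
  pose proof (ex_RInt_Re f a b Hf). pose proof (ex_RInt_Re g a b Hg).
  pose proof (ex_RInt_Im f a b Hf). pose proof (ex_RInt_Im g a b Hg).
  unfold CInt, Cplus. simpl.
  f_equal; apply (is_RInt_unique (V := R_CompleteNormedModule)).
  - apply (is_RInt_plus (V := R_NormedModule) (fun t => Re (f t)) (fun t => Re (g t)));
    apply (RInt_correct (V := R_CompleteNormedModule)); assumption.
  - apply (is_RInt_plus (V := R_NormedModule) (fun t => Im (f t)) (fun t => Im (g t)));
    apply (RInt_correct (V := R_CompleteNormedModule)); assumption.
Qed.

Lemma CInt_mult (f : R -> C) (k : C) a b :
  (forall t, continuous f t) ->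
  CInt (fun t => k * f t)%C a b = (k * CInt f a b)%C.
Proof.
  intros Hf.
  pose proof (ex_RInt_Re f a b Hf) as Hr. pose proof (ex_RInt_Im f a b Hf) as Hi.
  destruct k as [x y]. unfold CInt, Cmult. simpl. f_equal.
  - apply (is_RInt_unique (V := R_CompleteNormedModule)).
    apply (is_RInt_minus (V := R_NormedModule) (fun t => x * Re (f t)) (fun t => y * Im (f t)));
    apply (is_RInt_scal (V := R_NormedModule)); apply (RInt_correct (V := R_CompleteNormedModule)); assumption.
  - apply (is_RInt_unique (V := R_CompleteNormedModule)).
    apply (is_RInt_plus (V := R_NormedModule) (fun t => x * Im (f t)) (fun t => y * Re (f t)));
    apply (is_RInt_scal (V := R_NormedModule)); apply (RInt_correct (V := R_CompleteNormedModule)); assumption.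
Qed.

Lemma im_le_Cmod (c : C) : Rabs (Im c) <= Cmod c.
Proof.
  apply Rle_trans with (2 := Rmax_Cmod c). apply Rmax_r.
Qed.

Lemma Cmod_le_sum (c : C) : Cmod c <= Rabs (Re c) + Rabs (Im c).
Proof.
  replace c with (RtoC (Re c) + Ci * RtoC (Im c))%C at 1.
  - apply Rle_trans with (1 := Cmod_triangle _ _).
    rewrite Cmod_mult, Cmod_Ci, !Cmod_R. lra.
  - apply injective_projections; simpl; unfold Re, Im; ring.
Qed.

Lemma CInt_bound (f : R -> C) a b M : a <= b ->
  (forall t, continuous f t) -> (forall t, a <= t <= b -> Cmod (f t) <= M) ->
  Cmod (CInt f a b) <= 2 * (M * (b - a)).
Proof.
  intros Hab Hf HM.
  apply Rle_trans with (1 := Cmod_le_sum _).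
  assert (Hc : is_RInt (fun _ : R => M) a b (M * (b - a))).
  { rewrite Rmult_comm. apply (is_RInt_const (V := R_NormedModule)). }
  assert (H1 : Rabs (Re (CInt f a b)) <= M * (b - a)).
  { apply (norm_RInt_le (V := R_NormedModule) (fun t => Re (f t)) (fun _ => M) a b);
    [exact Hab| |apply (RInt_correct (V := R_CompleteNormedModule)), ex_RInt_Re, Hf|exact Hc].
    intros t Ht. apply Rle_trans with (1 := re_le_Cmod _). apply HM, Ht. }
  assert (H2 : Rabs (Im (CInt f a b)) <= M * (b - a)).
  { apply (norm_RInt_le (V := R_NormedModule) (fun t => Im (f t)) (fun _ => M) a b);
    [exact Hab| |apply (RInt_correct (V := R_CompleteNormedModule)), ex_RInt_Im, Hf|exact Hc].
    intros t Ht. apply Rle_trans with (1 := im_le_Cmod _). apply HM, Ht. }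
  lra.
Qed.

(** A Lipschitz bound on the kernel, uniform over the interval of integration, passes
    to the integral. *)
Lemma CInt_continuous (k : C -> R -> C) (a b r M : R) (w0 : C) :
  a <= b -> 0 < r -> 0 <= M ->
  (forall w, Cmod (w - w0) < r -> forall t, continuous (k w) t) ->
  (forall w t, Cmod (w - w0) < r -> a <= t <= b ->
     Cmod (k w t - k w0 t) <= M * Cmod (w - w0)) ->
  continuous (fun w => CInt (k w) a b) w0.
Proof.
  intros Hab Hr HM Hk HL. apply continuous_disc. intros e He.
  set (N := 2 * (M * (b - a))).
  assert (HN : 0 <= N) by (unfold N; apply Rmult_le_pos; [lra|apply Rmult_le_pos; lra]).
  exists (Rmin r (e / (N + 1))). split.
  { apply Rmin_pos; [exact Hr|apply Rdiv_lt_0_compat; lra]. }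
  intros w Hw.
  assert (Hw1 : Cmod (w - w0) < r) by (apply Rlt_le_trans with (1 := Hw), Rmin_l).
  assert (Hw2 : Cmod (w - w0) < e / (N + 1)) by (apply Rlt_le_trans with (1 := Hw), Rmin_r).
  assert (Hw0 : Cmod (w0 - w0) < r).
  { replace (w0 - w0)%C with (RtoC 0) by ring. rewrite Cmod_0. exact Hr. }
  assert (Hop : forall t, continuous (fun t => RtoC (-1) * k w0 t)%C t).
  { intros t. pose proof (Hk w0 Hw0 t). ccont. }
  replace (CInt (k w) a b - CInt (k w0) a b)%C
    with (CInt (fun t => k w t + RtoC (-1) * k w0 t)%C a b).
  - apply Rle_lt_trans with (2 * (M * Cmod (w - w0) * (b - a))).
    + apply CInt_bound; [exact Hab| |].
      * intros t. pose proof (Hk w Hw1 t). pose proof (Hop t). ccont.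
      * intros t Ht.
        replace (k w t + RtoC (-1) * k w0 t)%C with (k w t - k w0 t)%C by ring.
        apply HL; assumption.
    + replace (2 * (M * Cmod (w - w0) * (b - a))) with (N * Cmod (w - w0))
        by (unfold N; ring).
      apply Rle_lt_trans with ((N + 1) * Cmod (w - w0)).
      * pose proof (Cmod_ge_0 (w - w0)). nra.
      * replace e with ((N + 1) * (e / (N + 1))) by (field; lra).
        apply Rmult_lt_compat_l; lra.
  - rewrite CInt_plus, CInt_mult by (exact Hop || (apply Hk; assumption)). ring.
Qed.

Lemma continuous_Cbounded (c : R -> C) a b : a <= b -> (forall t, continuous c t) ->
  exists M, 0 <= M /\ forall t, a <= t <= b -> Cmod (c t) <= M.
Proof.
  intros Hab Hc.
  assert (Hcont : forall t, continuity_pt (fun t => Rabs (Re (c t)) + Rabs (Im (c t))) t).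
  { intros t. apply continuity_pt_plus; apply (continuity_pt_comp _ Rabs);
    try apply Rcontinuity_abs; apply continuity_pt_filterlim;
    [apply continuous_Re|apply continuous_Im]; apply Hc. }
  destruct (continuity_ab_maj _ a b Hab (fun t _ => Hcont t)) as (t0 & H0 & _).
  exists (Rabs (Re (c t0)) + Rabs (Im (c t0))). split.
  - apply Rplus_le_le_0_compat; apply Rabs_pos.
  - intros t Ht. apply Rle_trans with (1 := Cmod_le_sum _). apply H0, Ht.
Qed.

(** * Cauchy integrals *)

(** The kernel [1 / (g - w)] has the explicit slope function
    [1 / ((g - w) (g - w0))] at [w0], and this can be integrated against [c] because all
    the kernels are Lipschitz near [w0].  The result is of class C^1 in [w] even for a
    density [c] that is merely continuous: this is where a derivative is gained. *)
Lemma Cderiv_cauchy_integral (g c : R -> C) (a b : R) (w0 : C) (d : R) :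
  a <= b -> (forall t, continuous g t) -> (forall t, continuous c t) -> 0 < d ->
  (forall t, d <= Cmod (g t - w0)) ->
  Cderiv (fun w => CInt (fun t => c t / (g t - w))%C a b) w0
     (CInt (fun t => c t / ((g t - w0) * (g t - w0)))%C a b) /\
  continuous (fun w => CInt (fun t => c t / ((g t - w) * (g t - w)))%C a b) w0.
Proof.
  intros Hab Hg Hc Hd Hdist.
  destruct (continuous_Cbounded c a b Hab Hc) as (M & HM & Hcb).
  assert (Hn0 : forall t, (g t - w0)%C <> 0).
  { intros t. apply Cmod_gt_0. specialize (Hdist t). lra. }
  assert (Hd' : forall w t, Cmod (w - w0) < d / 2 -> d / 2 <= Cmod (g t - w)).
  { intros w t Hw. specialize (Hdist t).
    assert (Cmod (g t - w0) <= Cmod (g t - w) + Cmod (w - w0)); [|lra].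
    replace (g t - w0)%C with ((g t - w) + (w - w0))%C by ring. apply Cmod_triangle. }
  assert (Hn : forall w, Cmod (w - w0) < d / 2 -> forall t, (g t - w)%C <> 0).
  { intros w Hw t. apply Cmod_gt_0. specialize (Hd' w t Hw). lra. }
  assert (H00 : Cmod (w0 - w0) < d / 2).
  { replace (w0 - w0)%C with (RtoC 0) by ring. rewrite Cmod_0. lra. }
  assert (Hk : forall w v, Cmod (w - w0) < d / 2 -> Cmod (v - w0) < d / 2 -> forall t,
     continuous (fun t => c t / ((g t - w) * (g t - v)))%C t).
  { intros w v Hw Hv t. pose proof (Hg t). pose proof (Hc t).
    apply (continuous_Cmult c (fun t => / ((g t - w) * (g t - v)))%C); [ccont|].
    apply continuous_Cinv; [ccont|]. apply Cmult_neq_0; auto. }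
  assert (Hk1 : forall w, Cmod (w - w0) < d / 2 -> forall t,
     continuous (fun t => c t / (g t - w))%C t).
  { intros w Hw t. pose proof (Hg t). pose proof (Hc t).
    apply (continuous_Cmult c (fun t => / (g t - w))%C); [ccont|].
    apply continuous_Cinv; [ccont|]. auto. }
  assert (Hq : forall w t, Cmod (w - w0) < d / 2 -> Cmod (/ (g t - w)) <= 2 / d).
  { intros w t Hw. rewrite Cmod_inv by auto.
    replace (2 / d) with (/ (d / 2)) by (field; lra).
    apply Rinv_le_contravar; [lra|auto]. }
  assert (Hprod : forall t x1 x2 x3, a <= t <= b -> Cmod x1 <= 2 / d -> Cmod x2 <= 2 / d ->
     Cmod x3 <= 2 / d -> Cmod (c t * x1 * x2 * x3) <= M * (2 / d) * (2 / d) * (2 / d)).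
  { intros t x1 x2 x3 Ht H1 H2 H3.
    rewrite !Cmod_mult. pose proof (Hcb t Ht).
    repeat (apply Rmult_le_compat; try apply Cmod_ge_0; try assumption;
      repeat (apply Rmult_le_pos; try apply Cmod_ge_0)). }
  set (L := M * (2 / d) * (2 / d) * (2 / d)) in *.
  assert (HL : 0 <= L).
  { unfold L. assert (0 < 2 / d) by (apply Rdiv_lt_0_compat; lra).
    repeat (apply Rmult_le_pos; [|lra]). exact HM. }
  split.
  - exists (fun w => CInt (fun t => c t / ((g t - w) * (g t - w0)))%C a b).
    split; [|split; [reflexivity|]].
    + apply CInt_continuous with (r := d / 2) (M := L); [exact Hab|lra|exact HL| |].
      * intros w Hw. apply Hk; assumption.
      * intros w t Hw Ht.
        replace (c t / ((g t - w) * (g t - w0)) - c t / ((g t - w0) * (g t - w0)))%C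
          with (c t * / (g t - w) * / (g t - w0) * / (g t - w0) * (w - w0))%C
          by (field; split; auto).
        rewrite Cmod_mult. apply Rmult_le_compat_r; [apply Cmod_ge_0|].
        apply Hprod; auto.
    + apply locally_disc. exists (d / 2). split; [lra|]. intros w Hw.
      rewrite Cmult_comm, <- CInt_mult by (apply Hk; assumption).
      replace (CInt (fun t => c t / (g t - w)) a b - CInt (fun t => c t / (g t - w0)) a b)%C
        with (CInt (fun t => c t / (g t - w)) a b
              + RtoC (-1) * CInt (fun t => c t / (g t - w0)) a b)%C by ring.
      rewrite <- CInt_mult by (apply Hk1; assumption).
      rewrite <- CInt_plus.
      * apply CInt_ext. intros t. field. split; auto.
      * apply Hk1, Hw.
      * intros t. pose proof (Hk1 w0 H00 t). ccont.
  - apply CInt_continuous with (r := d / 2) (M := 2 * L); [exact Hab|lra|lra| |].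
    + intros w Hw. apply Hk; assumption.
    + intros w t Hw Ht.
      replace (c t / ((g t - w) * (g t - w)) - c t / ((g t - w0) * (g t - w0)))%C
        with ((c t * / (g t - w) * / (g t - w) * / (g t - w0)
               + c t * / (g t - w) * / (g t - w0) * / (g t - w0)) * (w - w0))%C
        by (field; split; auto).
      rewrite Cmod_mult. apply Rmult_le_compat_r; [apply Cmod_ge_0|].
      apply Rle_trans with (1 := Cmod_triangle _ _).
      pose proof (Hprod t _ _ _ Ht (Hq w t Hw) (Hq w t Hw) (Hq w0 t H00)).
      pose proof (Hprod t _ _ _ Ht (Hq w t Hw) (Hq w0 t H00) (Hq w0 t H00)). lra.
Qed.

(** * Cauchy's formula on a circle *)

(** If [t] times the [t]-derivative of the integrand is a [u]-derivative of a
    [T]-periodic function [B], then the integral does not depend on [t].  The factor [t]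
    lets the homotopy contract a circle to a point at [t = 0]: the derivative of the
    integral vanishes for [t <> 0], and continuity covers [t = 0].  The margin around the interval
    from 0 to 1 gives two-sided derivatives at both ends. *)
Lemma RInt_homotopy (A A' B : R -> R -> R) (T : R) : 0 < T ->
  (forall t u, -1/2 < t < 3/2 -> is_derive (fun s => A s u) t (A' t u)) ->
  (forall t u, -1/2 < t < 3/2 ->
     continuous (fun z : R * R => A' (fst z) (snd z)) (t, u)) ->
  (forall t u, -1/2 < t < 3/2 -> is_derive (B t) u (t * A' t u)) ->
  (forall t, -1/2 < t < 3/2 -> B t 0 = B t T) ->
  (forall t u, -1/2 < t < 3/2 -> continuous (A t) u) ->
  RInt (A 0) 0 T = RInt (A 1) 0 T.
Proof.
  intros HT HA HA' HB HBT HAc.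
  assert (HA1 : forall t u, -1/2 < t < 3/2 -> continuous (A' t) u).
  { intros t u Ht. apply (continuous_comp (fun u => (t, u)) (fun z : R * R => A' (fst z) (snd z))).
    - apply (continuous_comp_2 (fun _ => t) (fun u : R => u) (fun a b : R => (a, b)));
      [apply continuous_const|apply continuous_id|].
      intros P HP. destruct HP as [e He]. exists e. intros [x y] Hxy. apply He. exact Hxy.
    - apply HA', Ht. }
  assert (Hnear : forall t, -1/2 < t < 3/2 -> locally t (fun s => -1/2 < s < 3/2)).
  { intros t Ht. apply (open_and (fun s => -1/2 < s) (fun s => s < 3/2)).
    - apply open_gt.
    - apply open_lt.
    - exact Ht. }
  assert (Hint : forall t, -1/2 < t < 3/2 -> ex_RInt (A t) 0 T).
  { intros t Ht. apply (ex_RInt_continuous (V := R_CompleteNormedModule)).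
    intros u _. apply HAc, Ht. }
  assert (Hder : forall t, -1/2 < t < 3/2 ->
    is_derive (fun s => RInt (A s) 0 T) t (RInt (A' t) 0 T)).
  { intros t Ht.
    replace (RInt (A' t) 0 T) with (RInt (fun u => Derive (fun s => A s u) t) 0 T).
    2:{ apply RInt_ext. intros u _. apply is_derive_unique, HA, Ht. }
    apply (is_derive_RInt_param A 0 T t).
    - generalize (Hnear t Ht). apply filter_imp. intros s Hs u _.
      exists (A' s u). apply HA, Hs.
    - intros u _. apply continuity_2d_pt_ext_loc with A'.
      + destruct (Hnear t Ht) as [e He]. exists e. intros s v Hs _.
        symmetry. apply is_derive_unique, HA, He. exact Hs.
      + apply continuity_2d_pt_filterlim. apply HA', Ht.
    - generalize (Hnear t Ht). apply filter_imp. intros s Hs. apply Hint, Hs. }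
  (* [B] is a primitive of [t * A' t] with equal values at 0 and [T]. *)
  assert (Hzero : forall t, -1/2 < t < 3/2 -> t <> 0 -> RInt (A' t) 0 T = 0).
  { intros t Ht Hn.
    assert (H1 : is_RInt (fun u => t * A' t u) 0 T (minus (B t T) (B t 0))).
    { apply (is_RInt_derive (V := R_CompleteNormedModule) (B t)).
      - intros u _. apply HB, Ht.
      - intros u _. apply continuous_Rmult; [apply continuous_const|apply HA1, Ht]. }
    assert (H2 : is_RInt (fun u => t * A' t u) 0 T (t * RInt (A' t) 0 T)).
    { apply (is_RInt_scal (V := R_NormedModule)).
      apply (RInt_correct (V := R_CompleteNormedModule)).
      apply (ex_RInt_continuous (V := R_CompleteNormedModule)).
      intros u _. apply HA1, Ht. }
    apply (is_RInt_unique (V := R_CompleteNormedModule)) in H1.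
    apply (is_RInt_unique (V := R_CompleteNormedModule)) in H2.
    rewrite H1 in H2. rewrite <- HBT in H2 by exact Ht.
    unfold minus, plus, opp in H2; simpl in H2.
    apply Rmult_eq_reg_l with t; [|exact Hn]. rewrite <- H2. ring. }
  destruct (MVT_gen (fun s => RInt (A s) 0 T) 0 1 (fun _ => 0)) as (x & _ & Hx).
  - rewrite Rmin_left, Rmax_right by lra. intros t Ht.
    assert (Ht1 : -1/2 < t < 3/2) by lra. pose proof (Hder t Ht1) as Hd.
    rewrite Hzero in Hd by lra. exact Hd.
  - rewrite Rmin_left, Rmax_right by lra. intros t Ht.
    apply continuity_pt_filterlim.
    apply (ex_derive_continuous (V := R_NormedModule) (fun s => RInt (A s) 0 T) t).
    eexists. apply Hder. lra.
  - lra.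
Qed.

Lemma CInt_homotopy (A A' B : R -> R -> C) (T : R) : 0 < T ->
  (forall t u, -1/2 < t < 3/2 -> curve_deriv (fun s => A s u) t (A' t u)) ->
  (forall t u, -1/2 < t < 3/2 ->
     continuous (fun z : R * R => A' (fst z) (snd z)) (t, u)) ->
  (forall t u, -1/2 < t < 3/2 -> curve_deriv (B t) u (RtoC t * A' t u)%C) ->
  (forall t, -1/2 < t < 3/2 -> B t 0 = B t T) ->
  (forall t u, -1/2 < t < 3/2 -> continuous (A t) u) ->
  CInt (A 0) 0 T = CInt (A 1) 0 T.
Proof.
  intros HT HA HA' HB HBT HAc.
  assert (E : forall t z, Re (RtoC t * z)%C = t * Re z /\ Im (RtoC t * z)%C = t * Im z).
  { intros t z. unfold Re, Im; simpl. split; ring. }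
  unfold CInt. f_equal.
  - apply (RInt_homotopy (fun t u => Re (A t u)) (fun t u => Re (A' t u))
             (fun t u => Re (B t u))); try assumption.
    + intros t u Ht. apply HA, Ht.
    + intros t u Ht. exact (continuous_Re _ _ (HA' t u Ht)).
    + intros t u Ht. rewrite <- (proj1 (E t _)). apply HB, Ht.
    + intros t Ht. rewrite HBT by exact Ht. reflexivity.
    + intros t u Ht. exact (continuous_Re _ _ (HAc t u Ht)).
  - apply (RInt_homotopy (fun t u => Im (A t u)) (fun t u => Im (A' t u))
             (fun t u => Im (B t u))); try assumption.
    + intros t u Ht. apply HA, Ht.
    + intros t u Ht. exact (continuous_Im _ _ (HA' t u Ht)).
    + intros t u Ht. rewrite <- (proj2 (E t _)). apply HB, Ht.
    + intros t Ht. rewrite HBT by exact Ht. reflexivity.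
    + intros t u Ht. exact (continuous_Im _ _ (HAc t u Ht)).
Qed.

Definition circle (r u : R) : C := (r * cos u, r * sin u).

Lemma Cmod_circle r u : 0 <= r -> Cmod (circle r u) = r.
Proof.
  intros Hr. unfold Cmod, circle. cbn [fst snd].
  replace ((r * cos u) ^ 2 + (r * sin u) ^ 2) with (r ^ 2).
  - apply sqrt_pow2, Hr.
  - pose proof (sin2_cos2 u) as H. unfold Rsqr in H.
    replace (r ^ 2) with (r ^ 2 * (sin u * sin u + cos u * cos u)) by (rewrite H; ring).
    ring.
Qed.

Lemma curve_deriv_circle r u : curve_deriv (circle r) u (Ci * circle r u)%C.
Proof.
  split; unfold circle, Re, Im; simpl; auto_derive; auto; ring.
Qed.

Lemma curve_deriv_continuous c t l : curve_deriv c t l -> continuous c t.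
Proof.
  intros [H1 H2]. apply continuous_C_pair;
  apply (ex_derive_continuous (V := R_NormedModule)); eexists; eassumption.
Qed.

Lemma circle_2PI r : circle r 0 = circle r (2 * PI).
Proof. unfold circle. rewrite cos_2PI, sin_2PI, cos_0, sin_0. reflexivity. Qed.

Lemma curve_deriv_affine (c : R -> C) (t : R) (l p k : C) :
  curve_deriv c t l -> curve_deriv (fun u => p + k * (c u - p))%C t (k * l)%C.
Proof.
  intros H. apply (Cderiv_curve (fun z => p + k * (z - p))%C c t k l); [|exact H].
  exists (fun _ => k). split; [ccont|split; [reflexivity|]].
  apply filter_forall. intros w. ring.
Qed.

Lemma curve_deriv_segment (p q : C) (t : R) :
  curve_deriv (fun s => p + RtoC s * (q - p))%C t (q - p)%C.
Proof.
  split; unfold Re, Im; simpl; auto_derive; auto; ring.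
Qed.

Lemma continuous_RtoC {U : UniformSpace} (f : U -> R) x :
  continuous f x -> continuous (fun y => RtoC (f y)) x.
Proof.
  intros H. apply continuous_C_pair; [exact H|apply continuous_const].
Qed.

(** Contract the circle to [w] by the homotopy [t |-> w + t (g - w)].  With the weight
    [circle r u / (g - w)] the [t]-derivative of the integrand is
    [f' (w + t (g - w)) * circle r u], and the [u]-derivative of
    [- Ci * f (w + t (g - w))] is [t] times that, as [circle r] has derivative
    [Ci * circle r].  The integral on the left is left unevaluated: it would be
    [2 * PI], but for the division lemma it is enough that it is holomorphic in [w] and
    nonzero at the centre. *)
Lemma cauchy_formula (D : C -> Prop) (f : C -> C) (z0 w : C) (r : R) :
  (forall z, Cmod (z - z0) < 2 * r -> D z) -> hol D f -> Cmod (w - z0) < r ->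
  (f w * CInt (fun u => circle r u / (z0 + circle r u - w)) 0 (2 * PI))%C
  = CInt (fun u => f (z0 + circle r u)%C * circle r u / (z0 + circle r u - w))%C 0 (2 * PI).
Proof.
  intros HD (f' & Hf) Hw.
  assert (Hr : 0 < r) by (pose proof (Cmod_ge_0 (w - z0)); lra).
  set (g := fun u => (z0 + circle r u)%C).
  assert (Hcc : forall u, continuous (circle r) u)
    by (intros u; apply curve_deriv_continuous with (1 := curve_deriv_circle r u)).
  assert (Hgc : forall u, continuous g u)
    by (intros u; pose proof (Hcc u); unfold g; ccont).
  assert (Hgd : forall u, curve_deriv g u (Ci * circle r u)%C).
  { intros u. unfold g. destruct (curve_deriv_circle r u) as [H1 H2].
    split; unfold circle, Re, Im in *; simpl in *; auto_derive; auto; ring. }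
  assert (Hn : forall u, (g u - w)%C <> 0).
  { intros u E. assert (Ew : (w - z0)%C = circle r u).
    { apply Ceq_minus in E. rewrite <- E. unfold g. ring. }
    rewrite Ew, Cmod_circle in Hw; lra. }
  (* For [t] up to 3/2 the points stay in the disc of radius [2 * r]. *)
  assert (HDt : forall t u, -1/2 < t < 3/2 -> D (w + RtoC t * (g u - w))%C).
  { intros t u Ht. apply HD.
    replace (w + RtoC t * (g u - w) - z0)%C
      with (RtoC (1 - t) * (w - z0) + RtoC t * circle r u)%C
      by (rewrite RtoC_minus; unfold g; ring).
    apply Rle_lt_trans with (1 := Cmod_triangle _ _).
    rewrite !Cmod_mult, !Cmod_R, Cmod_circle by lra.
    pose proof (Cmod_ge_0 (w - z0)).
    destruct (Rle_dec 0 t), (Rle_dec t 1).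
    - rewrite !Rabs_pos_eq by lra. nra.
    - rewrite (Rabs_left1 (1 - t)), (Rabs_pos_eq t) by lra. nra.
    - rewrite (Rabs_left1 t), (Rabs_pos_eq (1 - t)) by lra. nra.
    - lra. }
  assert (Hgn : forall u, continuous (fun u => circle r u / (g u - w))%C u).
  { intros u. pose proof (Hcc u). pose proof (Hgc u).
    apply (continuous_Cmult (circle r) (fun u => / (g u - w))%C); [ccont|].
    apply continuous_Cinv; [ccont|apply Hn]. }
  pose (A := fun t u => (f (w + RtoC t * (g u - w)) * (circle r u / (g u - w)))%C).
  transitivity (CInt (A 0) 0 (2 * PI)).
  { rewrite <- CInt_mult by exact Hgn. apply CInt_ext. intros u. unfold A.
    replace (w + RtoC 0 * (g u - w))%C with w by ring. reflexivity. }
  transitivity (CInt (A 1) 0 (2 * PI)).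
  2:{ apply CInt_ext. intros u. unfold A.
      replace (w + RtoC 1 * (g u - w))%C with (g u) by ring.
      fold (g u). unfold Cdiv. ring. }
  apply (CInt_homotopy A
    (fun t u => f' (w + RtoC t * (g u - w)) * circle r u)%C
    (fun t u => f (w + RtoC t * (g u - w)) * - Ci)%C).
  - pose proof PI_RGT_0. lra.
  - intros t u Ht. unfold A.
    replace (f' (w + RtoC t * (g u - w)) * circle r u)%C
      with (f' (w + RtoC t * (g u - w)) * (g u - w) * (circle r u / (g u - w)))%C
      by (field; apply Hn).
    apply (curve_deriv_mult_const (fun s => f (w + RtoC s * (g u - w))%C)).
    apply (Cderiv_curve f (fun s => w + RtoC s * (g u - w))%C).
    + apply Hf, HDt, Ht.
    + apply curve_deriv_segment.
  - intros t u Ht.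
    assert (H2 : continuous (fun z : R * R => snd z) (t, u)) by apply continuous_snd.
    assert (H1 : continuous (fun z : R * R => fst z) (t, u)) by apply continuous_fst.
    apply continuous_RtoC in H1.
    assert (H3 : continuous (fun z : R * R => circle r (snd z)) (t, u)).
    { apply (continuous_comp (fun z : R * R => snd z) (circle r)); [exact H2|apply Hcc]. }
    assert (H4 : continuous (fun z : R * R => g (snd z)) (t, u)).
    { apply (continuous_comp (fun z : R * R => snd z) g); [exact H2|apply Hgc]. }
    apply (continuous_Cmult (fun z => f' (w + RtoC (fst z) * (g (snd z) - w))%C)
             (fun z => circle r (snd z))); [|exact H3].
    apply (continuous_comp (fun z : R * R => w + RtoC (fst z) * (g (snd z) - w))%C f').
    + ccont.
    + apply Hf, (HDt t u), Ht.
  - intros t u Ht.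
    replace (RtoC t * (f' (w + RtoC t * (g u - w)) * circle r u))%C
      with (f' (w + RtoC t * (g u - w)) * (RtoC t * (Ci * circle r u)) * - Ci)%C.
    2:{ replace (f' (w + RtoC t * (g u - w)) * (RtoC t * (Ci * circle r u)) * - Ci)%C
          with (RtoC t * (f' (w + RtoC t * (g u - w)) * circle r u) * - (Ci * Ci))%C by ring.
        replace (- (Ci * Ci))%C with (RtoC 1); [ring|].
        apply injective_projections; simpl; ring. }
    apply (curve_deriv_mult_const (fun u => f (w + RtoC t * (g u - w))%C)).
    apply (Cderiv_curve f (fun u => w + RtoC t * (g u - w))%C).
    + apply Hf, HDt, Ht.
    + apply curve_deriv_affine, Hgd.
  - intros t Ht. unfold g. rewrite <- circle_2PI. reflexivity.
  - intros t u Ht. unfold A.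
    apply (continuous_Cmult (fun u => f (w + RtoC t * (g u - w))%C)
             (fun u => circle r u / (g u - w))%C); [|apply Hgn].
    apply (continuous_comp (fun u => w + RtoC t * (g u - w))%C f).
    + pose proof (Hgc u). ccont.
    + apply Cderiv_continuous with (f' (w + RtoC t * (g u - w))%C), Hf, HDt, Ht.
Qed.

(** * Dividing a holomorphic function by a linear factor *)

Lemma CInt_const_1 b : CInt (fun _ => RtoC 1) 0 b = RtoC b.
Proof.
  unfold CInt. apply injective_projections; simpl; rewrite RInt_const;
  unfold scal; simpl; unfold mult; simpl; ring.
Qed.

(** Cauchy's formula reads [f * N = M] near [z0], with [M] and [N] integrals over a
    circle around [z0].  As [circle r / (g - w) = 1 + (w - z0) / (g - w)] and the mean of
    [f] over the circle vanishes with [f z0], [M w] is [w - z0] times a Cauchy integral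
    [K w].  So the quotient of [f] by [w - z0] is [K / N], which is holomorphic at [z0]
    too. *)
Lemma local_quotient (D : C -> Prop) (f : C -> C) (z0 : C) :
  open D -> hol D f -> D z0 -> f z0 = RtoC 0 ->
  exists (rho : R) (q : C -> C), 0 < rho /\
    hol (fun w => Cmod (w - z0) < rho) q /\
    forall w, Cmod (w - z0) < rho -> f w = ((w - z0) * q w)%C.
Proof.
  intros HO Hf Hz0 Hf0.
  destruct (proj1 (locally_disc z0 D) (HO z0 Hz0)) as (d & Hd & HdD).
  set (r := d / 2). assert (Hr : 0 < r) by (unfold r; lra).
  assert (HD : forall z, Cmod (z - z0) < 2 * r -> D z).
  { intros z Hz. apply HdD. unfold r in Hz. lra. }
  set (g := fun u => (z0 + circle r u)%C).
  assert (Hcc : forall u, continuous (circle r) u)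
    by (intros u; apply curve_deriv_continuous with (1 := curve_deriv_circle r u)).
  assert (Hgc : forall u, continuous g u)
    by (intros u; pose proof (Hcc u); unfold g; ccont).
  assert (Hfg : forall u, continuous (fun u => f (g u)) u).
  { intros u. apply (continuous_comp g f); [apply Hgc|].
    apply hol_continuous with (1 := Hf), HD. unfold g.
    replace (z0 + circle r u - z0)%C with (circle r u) by ring.
    rewrite Cmod_circle; lra. }
  assert (HP : 0 <= 2 * PI) by (pose proof PI_RGT_0; lra).
  assert (Hdist : forall w u, r - Cmod (w - z0) <= Cmod (g u - w)).
  { intros w u.
    assert (Cmod (circle r u) <= Cmod (g u - w) + Cmod (w - z0)) as H.
    { replace (circle r u) with ((g u - w) + (w - z0))%C by (unfold g; ring).
      apply Cmod_triangle. }
    rewrite Cmod_circle in H; lra. }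
  set (N := fun w => CInt (fun u => circle r u / (g u - w))%C 0 (2 * PI)).
  set (K := fun w => CInt (fun u => f (g u) / (g u - w))%C 0 (2 * PI)).
  assert (HN : hol (fun w => Cmod (w - z0) < r) N).
  { eexists. intros w Hw.
    apply (Cderiv_cauchy_integral g (circle r) 0 (2 * PI) w (r - Cmod (w - z0)) HP Hgc Hcc);
    [lra|auto]. }
  assert (HK : hol (fun w => Cmod (w - z0) < r) K).
  { eexists. intros w Hw.
    apply (Cderiv_cauchy_integral g (fun u => f (g u)) 0 (2 * PI) w (r - Cmod (w - z0))
             HP Hgc Hfg); [lra|auto]. }
  assert (H00 : Cmod (z0 - z0) < r).
  { replace (z0 - z0)%C with (RtoC 0) by ring. rewrite Cmod_0. exact Hr. }
  assert (Hcn : forall u, circle r u <> RtoC 0).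
  { intros u E. apply (f_equal Cmod) in E. rewrite Cmod_circle, Cmod_0 in E; lra. }
  assert (HN0 : N z0 <> RtoC 0).
  { unfold N. rewrite (CInt_ext _ (fun _ => RtoC 1)).
    - rewrite CInt_const_1. intros E. apply RtoC_inj in E. pose proof PI_RGT_0. lra.
    - intros u. unfold g. field.
      replace (z0 + circle r u - z0)%C with (circle r u) by ring. apply Hcn. }
  (* Cauchy's formula at the centre: the mean value of [f] over the circle is [f z0]. *)
  assert (Hmean : CInt (fun u => f (g u)) 0 (2 * PI) = RtoC 0).
  { pose proof (cauchy_formula D f z0 z0 r HD Hf H00) as E.
    rewrite Hf0, Cmult_0_l in E. rewrite E. apply CInt_ext. intros u.
    unfold g. field. replace (z0 + circle r u - z0)%C with (circle r u) by ring.
    apply Hcn. }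
  assert (Hmain : forall w, Cmod (w - z0) < r -> (f w * N w = (w - z0) * K w)%C).
  { intros w Hw.
    assert (Hn : forall u, (g u - w)%C <> RtoC 0).
    { intros u. apply Cmod_gt_0. specialize (Hdist w u). lra. }
    assert (Hcq : forall u, continuous (fun u => f (g u) / (g u - w))%C u).
    { intros u. pose proof (Hgc u).
      apply (continuous_Cmult (fun u => f (g u)) (fun u => / (g u - w))%C); [apply Hfg|].
      apply continuous_Cinv; [ccont|apply Hn]. }
    transitivity (CInt (fun u => f (g u) * circle r u / (g u - w))%C 0 (2 * PI));
      [exact (cauchy_formula D f z0 w r HD Hf Hw)|unfold K].
    rewrite <- CInt_mult by exact Hcq.
    transitivity (CInt (fun u => f (g u)) 0 (2 * PI)
      + CInt (fun u => (w - z0) * (f (g u) / (g u - w)))%C 0 (2 * PI))%C.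
    - rewrite <- CInt_plus.
      + apply CInt_ext. intros u. fold (g u). specialize (Hn u).
        unfold g in *. field. exact Hn.
      + exact Hfg.
      + intros u. pose proof (Hcq u). ccont.
    - rewrite Hmean. ring. }
  destruct (proj1 (locally_disc z0 _) (locally_neq N z0 _ (hol_continuous _ _ _ HN H00) HN0))
    as (r' & Hr' & HNn).
  exists (Rmin r r'), (fun w => K w * / N w)%C.
  assert (Hrho : forall w, Cmod (w - z0) < Rmin r r' -> Cmod (w - z0) < r /\ Cmod (w - z0) < r').
  { intros w Hw. split; [apply Rlt_le_trans with (1 := Hw), Rmin_l
      |apply Rlt_le_trans with (1 := Hw), Rmin_r]. }
  split; [apply Rmin_pos; assumption|split].
  - apply hol_mult; [|apply hol_inv].
    + apply hol_subset with (2 := HK). intros z Hz. apply Hrho, Hz.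
    + intros z Hz. apply HNn, Hrho, Hz.
    + apply hol_subset with (2 := HN). intros z Hz. apply Hrho, Hz.
  - intros w Hw. destruct (Hrho w Hw) as [Hw1 Hw2].
    pose proof (HNn w Hw2) as HNw. specialize (Hmain w Hw1).
    transitivity (f w * N w * / N w)%C; [field; exact HNw|].
    rewrite Hmain. ring.
Qed.

(** The quotient is given by the local lemma near [z0] and by division elsewhere.  Its
    derivative is continuous at [z0] since uniqueness of derivatives identifies the two
    descriptions on a punctured neighbourhood. *)
Theorem hol_divide (D : C -> Prop) (f : C -> C) (z0 : C) :
  open D -> hol D f -> D z0 -> f z0 = RtoC 0 ->
  exists q : C -> C, hol D q /\ forall z, D z -> f z = ((z - z0) * q z)%C.
Proof.
  intros HO Hf Hz0 Hf0.
  destruct (local_quotient D f z0 HO Hf Hz0 Hf0) as (rho & k & Hrho & (k' & Hk) & Hfk).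
  assert (Hff := Hf). destruct Hff as (f' & Hf').
  set (h := fun z => (f z * / (z - z0))%C).
  set (q := fun z => if Ceq_dec z z0 then k z0 else h z).
  assert (Hh : exists h', forall z, D z /\ z <> z0 -> Cderiv h z (h' z) /\ continuous h' z).
  { apply (hol_mult _ f (fun z => / (z - z0))%C).
    - apply hol_subset with (2 := Hf). tauto.
    - apply hol_inv.
      + intros z [_ Hz] E. apply Hz, Ceq_minus, E.
      + apply (hol_minus_const _ z0). }
  destruct Hh as (h' & Hh).
  assert (Hne : forall z, z <> z0 -> locally z (fun w : C => w <> z0)).
  { intros z Hz. apply (locally_neq (fun w => w)); [apply continuous_id|exact Hz]. }
  assert (H00 : Cmod (z0 - z0) < rho).
  { replace (z0 - z0)%C with (RtoC 0) by ring. rewrite Cmod_0. exact Hrho. }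
  assert (Hqk : forall z, Cmod (z - z0) < rho -> q z = k z).
  { intros z Hz. unfold q. destruct (Ceq_dec z z0) as [->|Hn]; [reflexivity|].
    unfold h. rewrite (Hfk z Hz). field. intros E. apply Hn, Ceq_minus, E. }
  assert (Hqh : forall z, z <> z0 -> q z = h z).
  { intros z Hz. unfold q. destruct (Ceq_dec z z0); [contradiction|reflexivity]. }
  assert (Hqk' : forall z, Cmod (z - z0) < rho -> Cderiv q z (k' z)).
  { intros z Hz. apply Cderiv_ext_loc with k; [|apply Hk, Hz].
    generalize (disc_open z0 rho z Hz). apply filter_imp.
    intros w Hw. symmetry. apply Hqk, Hw. }
  assert (Hqh' : forall z, D z -> z <> z0 -> Cderiv q z (h' z)).
  { intros z Dz Hz. apply Cderiv_ext_loc with h; [|apply Hh; split; assumption].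
    generalize (Hne z Hz). apply filter_imp. intros w Hw. symmetry. apply Hqh, Hw. }
  exists q. split.
  - exists (fun z => if Ceq_dec z z0 then k' z0 else h' z).
    intros z Dz. destruct (Ceq_dec z z0) as [->|Hz].
    + split; [apply Hqk', H00|].
      apply continuous_ext_loc with k'; [|apply Hk, H00].
      generalize (filter_and _ _ (disc_open z0 rho z0 H00) (HO z0 Hz0)).
      apply filter_imp. intros w [Hw Dw].
      destruct (Ceq_dec w z0) as [->|Hn]; [reflexivity|].
      apply Cderiv_unique with q w; [apply Hqk', Hw|apply Hqh'; assumption].
    + split; [apply Hqh'; assumption|].
      apply continuous_ext_loc with h'; [|apply Hh; split; assumption].
      generalize (Hne z Hz). apply filter_imp. intros w Hw.
      destruct (Ceq_dec w z0); [contradiction|reflexivity].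
  - intros z Dz. unfold q. destruct (Ceq_dec z z0) as [->|Hz].
    + rewrite Hf0. ring.
    + unfold h. field. intros E. apply Hz, Ceq_minus, E.
Qed.

(** * The exponential of a complex quaternion *)

Definition Cexp (z : C) : C := (exp (Re z) * cos (Im z), exp (Re z) * sin (Im z)).

Definition Cis_series (a : nat -> C) (l : C) : Prop :=
  is_series (fun n => Re (a n)) (Re l) /\ is_series (fun n => Im (a n)) (Im l).

Lemma Cis_series_ext a b l :
  (forall n, a n = b n) -> Cis_series a l -> Cis_series b l.
Proof.
  intros E [H1 H2]. split; [apply (is_series_ext (fun n => Re (a n)))
    |apply (is_series_ext (fun n => Im (a n)))]; try assumption;
  intros n; rewrite E; reflexivity.
Qed.

Lemma is_series_Rplus (a b : nat -> R) (l m : R) :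
  is_series a l -> is_series b m -> is_series (fun n => a n + b n) (l + m).
Proof. apply (is_series_plus (V := R_NormedModule)). Qed.

Lemma is_series_Rscal (a : nat -> R) (l k : R) :
  is_series a l -> is_series (fun n => k * a n) (k * l).
Proof. apply (is_series_scal (V := R_NormedModule)). Qed.

Lemma Cis_series_plus a b l m : Cis_series a l -> Cis_series b m ->
  Cis_series (fun n => a n + b n)%C (l + m)%C.
Proof.
  intros [H1 H2] [H3 H4]. split.
  - exact (is_series_Rplus _ _ _ _ H1 H3).
  - exact (is_series_Rplus _ _ _ _ H2 H4).
Qed.

Lemma Cis_series_mult a l k : Cis_series a l ->
  Cis_series (fun n => k * a n)%C (k * l)%C.
Proof.
  intros [H1 H2]. destruct k as [x y]. split.
  - replace (Re ((x, y) * l)%C) with (x * Re l + - y * Im l)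
      by (unfold Re, Im; simpl; ring).
    apply (is_series_ext (fun n => x * Re (a n) + - y * Im (a n))).
    + intros n. unfold Re, Im; simpl; ring.
    + apply is_series_Rplus; apply is_series_Rscal; assumption.
  - replace (Im ((x, y) * l)%C) with (x * Im l + y * Re l)
      by (unfold Re, Im; simpl; ring).
    apply (is_series_ext (fun n => x * Im (a n) + y * Re (a n))).
    + intros n. unfold Re, Im; simpl; ring.
    + apply is_series_Rplus; apply is_series_Rscal; assumption.
Qed.

Definition fact_inv (n : nat) : R := / INR (fact n).

Lemma fact_inv_S n : INR (S n) * fact_inv (S n) = fact_inv n.
Proof.
  unfold fact_inv. rewrite fact_simpl, mult_INR. field.
  split; [apply INR_fact_neq_0|apply not_0_INR; lia].
Qed.

Lemma exp_coef_CV (a : nat -> R) (z : C) :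
  (forall n, Rabs (a n) <= Cmod z ^ n * fact_inv n) ->
  forall x, Rbar_lt (Rabs x) (CV_radius a).
Proof.
  intros H x. apply Rbar_lt_le_trans with (Finite (Rabs x + 1)); [simpl; lra|].
  apply (proj1 (CV_radius_bounded a)).
  set (r := Rabs x + 1).
  assert (Hr : 0 <= r) by (unfold r; pose proof (Rabs_pos x); lra).
  assert (Hm : 0 <= Cmod z * r) by (apply Rmult_le_pos; [apply Cmod_ge_0|exact Hr]).
  exists (exp (Cmod z * r)). intros n.
  rewrite Rabs_mult, (Rabs_pos_eq (r ^ n)) by (apply pow_le, Hr).
  apply Rle_trans with ((Cmod z * r) ^ n / INR (fact n)).
  - rewrite Rpow_mult_distr. unfold Rdiv. fold (fact_inv n).
    replace (Cmod z ^ n * r ^ n * fact_inv n) with (Cmod z ^ n * fact_inv n * r ^ n) by ring.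
    apply Rmult_le_compat_r; [apply pow_le, Hr|apply H].
  - apply Rle_trans with (2 := exp_ge_taylor _ n Hm).
    assert (Hpos : forall k, 0 <= (Cmod z * r) ^ k / INR (fact k)).
    { intros k. apply Rmult_le_pos; [apply pow_le, Hm|].
      apply Rlt_le, Rinv_0_lt_compat, INR_fact_lt_0. }
    destruct n; [apply Rle_refl|]. rewrite tech5.
    pose proof (cond_pos_sum _ n Hpos). lra.
Qed.

(** Along the ray [t |-> t * z] the real and imaginary parts [p], [q] of the exponential
    series are real power series of infinite radius that solve [p' = x p - y q],
    [q' = y p + x q].  Multiplying by [exp (- x t)] and rotating by the angle [- y t]
    gives two constants, which determine [p] and [q] at [t = 1]. *)
Lemma Cexp_series (z : C) :
  Cis_series (fun n => RtoC (fact_inv n) * z ^ n)%C (Cexp z).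
Proof.
  destruct z as [x y]. set (z := (x, y) : C).
  set (a := fun n => fact_inv n * Re (z ^ n)%C).
  set (b := fun n => fact_inv n * Im (z ^ n)%C).
  assert (Hfp : forall n, 0 <= fact_inv n).
  { intros n. apply Rlt_le, Rinv_0_lt_compat, INR_fact_lt_0. }
  assert (Ha : forall t, Rbar_lt (Rabs t) (CV_radius a)).
  { apply exp_coef_CV with z. intros n. unfold a.
    rewrite Rabs_mult, (Rabs_pos_eq _ (Hfp n)), Rmult_comm, <- Cmod_pow.
    apply Rmult_le_compat_r; [apply Hfp|apply re_le_Cmod]. }
  assert (Hb : forall t, Rbar_lt (Rabs t) (CV_radius b)).
  { apply exp_coef_CV with z. intros n. unfold b.
    rewrite Rabs_mult, (Rabs_pos_eq _ (Hfp n)), Rmult_comm, <- Cmod_pow.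
    apply Rmult_le_compat_r; [apply Hfp|apply im_le_Cmod]. }
  assert (Hea : forall t, ex_pseries a t) by (intros t; apply CV_radius_inside, Ha).
  assert (Heb : forall t, ex_pseries b t) by (intros t; apply CV_radius_inside, Hb).
  assert (Hlin : forall u v t,
    PSeries (PS_plus (PS_scal u a) (PS_scal v b)) t = u * PSeries a t + v * PSeries b t).
  { intros u v t. rewrite PSeries_plus.
    - rewrite !PSeries_scal. reflexivity.
    - apply ex_pseries_scal; [apply Rmult_comm|apply Hea].
    - apply ex_pseries_scal; [apply Rmult_comm|apply Heb]. }
  assert (Hda : forall t, is_derive (PSeries a) t (x * PSeries a t + - y * PSeries b t)).
  { intros t. rewrite <- Hlin.
    replace (PSeries (PS_plus (PS_scal x a) (PS_scal (- y) b)) t)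
      with (PSeries (PS_derive a) t); [apply is_derive_PSeries, Ha|].
    apply PSeries_ext. intros n. unfold PS_derive, PS_plus, PS_scal, a, b, plus, scal; simpl.
    unfold mult; simpl.
    change (INR (S n) * (fact_inv (S n) * Re (z * z ^ n)%C)
      = x * (fact_inv n * Re (z ^ n)%C) + - y * (fact_inv n * Im (z ^ n)%C)).
    rewrite <- Rmult_assoc, fact_inv_S. unfold z, Re, Im; simpl. ring. }
  assert (Hdb : forall t, is_derive (PSeries b) t (y * PSeries a t + x * PSeries b t)).
  { intros t. rewrite <- Hlin.
    replace (PSeries (PS_plus (PS_scal y a) (PS_scal x b)) t)
      with (PSeries (PS_derive b) t); [apply is_derive_PSeries, Hb|].
    apply PSeries_ext. intros n. unfold PS_derive, PS_plus, PS_scal, a, b, plus, scal; simpl.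
    unfold mult; simpl.
    change (INR (S n) * (fact_inv (S n) * Im (z * z ^ n)%C)
      = y * (fact_inv n * Re (z ^ n)%C) + x * (fact_inv n * Im (z ^ n)%C)).
    rewrite <- Rmult_assoc, fact_inv_S. unfold z, Re, Im; simpl. ring. }
  set (p := PSeries a) in *. set (q := PSeries b) in *.
  assert (Hp0 : p 0 = 1).
  { unfold p. rewrite PSeries_0. unfold a, fact_inv, Re; simpl. field. }
  assert (Hq0 : q 0 = 0).
  { unfold q. rewrite PSeries_0. unfold b, Im; simpl. ring. }
  assert (Hxp : forall t, ex_derive p t) by (intros t; eexists; apply Hda).
  assert (Hxq : forall t, ex_derive q t) by (intros t; eexists; apply Hdb).
  assert (HDp : forall t, Derive p t = x * p t + - y * q t)
    by (intros t; apply is_derive_unique, Hda).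
  assert (HDq : forall t, Derive q t = y * p t + x * q t)
    by (intros t; apply is_derive_unique, Hdb).
  assert (HU : p 0 = exp (- x * 1) * (p 1 * cos (y * 1) + q 1 * sin (y * 1))).
  { transitivity (exp (- x * 0) * (p 0 * cos (y * 0) + q 0 * sin (y * 0))).
    { rewrite !Rmult_0_r, exp_0, cos_0, sin_0. ring. }
    apply (eq_is_derive (fun t => exp (- x * t) * (p t * cos (y * t) + q t * sin (y * t)))); [|lra].
    intros t _. auto_derive; [repeat split; auto|].
    rewrite HDp, HDq. change (@zero _) with 0. ring. }
  assert (HV : q 0 = exp (- x * 1) * (q 1 * cos (y * 1) + - (p 1 * sin (y * 1)))).
  { transitivity (exp (- x * 0) * (q 0 * cos (y * 0) + - (p 0 * sin (y * 0)))).
    { rewrite !Rmult_0_r, exp_0, cos_0, sin_0. ring. }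
    apply (eq_is_derive (fun t => exp (- x * t) * (q t * cos (y * t) + - (p t * sin (y * t))))); [|lra].
    intros t _. auto_derive; [repeat split; auto|].
    rewrite HDp, HDq. change (@zero _) with 0. ring. }
  rewrite Hp0, !Rmult_1_r in HU. rewrite Hq0, !Rmult_1_r in HV.
  assert (He : exp x * exp (- x) = 1).
  { rewrite <- exp_plus. replace (x + - x) with 0 by ring. apply exp_0. }
  pose proof (sin2_cos2 y) as Hsc. unfold Rsqr in Hsc.
  assert (Hsum : p 1 * cos y + q 1 * sin y = exp x).
  { apply (f_equal (Rmult (exp x))) in HU. rewrite <- Rmult_assoc, He in HU. lra. }
  assert (Hdif : q 1 * cos y + - (p 1 * sin y) = 0).
  { apply (f_equal (Rmult (exp x))) in HV. rewrite <- Rmult_assoc, He in HV. lra. }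
  assert (Hp1 : p 1 = exp x * cos y).
  { rewrite <- Hsum. replace (p 1) with (p 1 * (sin y * sin y + cos y * cos y)) at 1
      by (rewrite Hsc; ring).
    transitivity ((p 1 * cos y + q 1 * sin y) * cos y - (q 1 * cos y + - (p 1 * sin y)) * sin y);
    [ring|rewrite Hdif; ring]. }
  assert (Hq1 : q 1 = exp x * sin y).
  { rewrite <- Hsum. replace (q 1) with (q 1 * (sin y * sin y + cos y * cos y)) at 1
      by (rewrite Hsc; ring).
    transitivity ((p 1 * cos y + q 1 * sin y) * sin y + (q 1 * cos y + - (p 1 * sin y)) * cos y);
    [ring|rewrite Hdif; ring]. }
  assert (Hex : forall c, ex_pseries c 1 -> is_series c (PSeries c 1)).
  { intros c Hc. apply PSeries_correct in Hc. apply is_pseries_R in Hc.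
    revert Hc. apply is_series_ext. intros n. rewrite pow1. apply Rmult_1_r. }
  split; unfold Cexp; simpl.
  - change (Re (x, y)) with x. change (Im (x, y)) with y. rewrite <- Hp1.
    apply (is_series_ext a); [|apply Hex, Hea].
    intros n. unfold a, Re; simpl; ring.
  - change (Re (x, y)) with x. change (Im (x, y)) with y. rewrite <- Hq1.
    apply (is_series_ext b); [|apply Hex, Heb].
    intros n. unfold b, Im; simpl; ring.
Qed.

Lemma Cexp_plus z w : Cexp (z + w)%C = (Cexp z * Cexp w)%C.
Proof.
  destruct z as [a b], w as [c d]. unfold Cexp, Re, Im; simpl.
  rewrite exp_plus, cos_plus, sin_plus. apply injective_projections; simpl; ring.
Qed.

Lemma Cexp_0 : Cexp 0 = 1.
Proof.
  unfold Cexp, Re, Im; simpl. rewrite exp_0, cos_0, sin_0.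
  apply injective_projections; simpl; ring.
Qed.

Lemma Cexp_neq_0 z : Cexp z <> 0.
Proof.
  intros E. assert (H : (Cexp z * Cexp (- z))%C = 1).
  { rewrite <- Cexp_plus. replace (z + - z)%C with (RtoC 0) by ring. apply Cexp_0. }
  rewrite E, Cmult_0_l in H. apply RtoC_inj in H. lra.
Qed.

Lemma Csqrt_exists (c : C) : exists s : C, (s * s)%C = c.
Proof.
  destruct c as [p q]. set (m := Cmod (p, q)).
  assert (Hm : m * m = p * p + q * q).
  { unfold m, Cmod. cbn [fst snd]. rewrite sqrt_sqrt; nra. }
  assert (Hm0 : 0 <= m) by apply Cmod_ge_0.
  assert (Hp : 0 <= (m + p) / 2) by nra.
  assert (Hn : 0 <= (m - p) / 2) by nra.
  pose proof (sqrt_sqrt _ Hp) as Hu. pose proof (sqrt_sqrt _ Hn) as Hv.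
  assert (Huv : sqrt ((m + p) / 2) * sqrt ((m - p) / 2) = Rabs q / 2).
  { rewrite <- sqrt_mult by assumption.
    replace ((m + p) / 2 * ((m - p) / 2)) with ((Rabs q / 2) ^ 2).
    - apply sqrt_pow2. pose proof (Rabs_pos q). lra.
    - pose proof (pow2_abs q). simpl in *. nra. }
  set (u := sqrt ((m + p) / 2)) in *. set (v := sqrt ((m - p) / 2)) in *.
  destruct (Rle_dec 0 q).
  - rewrite Rabs_pos_eq in Huv by assumption.
    exists (u, v). apply injective_projections; simpl; nra.
  - rewrite Rabs_left in Huv by lra.
    exists (u, - v). apply injective_projections; simpl; nra.
Qed.

(** [sinh s = 0] only for [s] an integer multiple of [PI * Ci]. *)
Lemma Cexp_opp_neq (s : C) : s <> 0 -> Cmod s < 1 -> Cexp s <> Cexp (- s).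
Proof.
  intros Hs H1 E. pose proof (im_le_Cmod s) as Hi.
  destruct s as [a b]. unfold Cexp, Re, Im in *; simpl in *.
  injection E as E1 E2. rewrite cos_neg in E1. rewrite sin_neg in E2.
  pose proof (exp_pos a). pose proof (exp_pos (- a)).
  assert (Hsin : sin b = 0) by nra.
  assert (Hb : b = 0).
  { pose proof (Rabs_def2 b 1 ltac:(lra)) as [Hb1 Hb2].
    pose proof PI2_1 as HPI. destruct (Rtotal_order b 0) as [Hn|[Hz|Hp]]; [|exact Hz|].
    - pose proof (sin_gt_0 (- b)) as Hg. rewrite sin_neg in Hg. lra.
    - pose proof (sin_gt_0 b). lra. }
  subst b. rewrite cos_0, !Rmult_1_r in E1. apply exp_inv in E1.
  apply Hs. apply injective_projections; simpl; lra.
Qed.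

(** If [v] is a vector with [v * v = - n], then the [k]-th power of [x + v] is [p + q v]
    for the pair [(p, q)] computed here.  The pair depends on [x] and [n] only, so the
    noncommutativity of quaternions disappears from the exponential series. *)
Fixpoint pow_coef (x n : C) (k : nat) : C * C :=
  match k with
  | O => (RtoC 1, RtoC 0)
  | S k => let (p, q) := pow_coef x n k in (x * p - n * q, p + x * q)%C
  end.

(** Choose [r] with [r * r = - n].  If [r] is nonzero, the powers of [x + v] combine the
    powers of the eigenvalues [x + r] and [x - r], whence [exp (x + v) = exp x * (c + s v)]
    with [c = cosh r] and [s = sinh r / r]; if [r = 0] then [v] is nilpotent and
    [c = s = 1].  Both coefficients are even in [r], so they depend on [n] alone. *)
Lemma pow_coef_series (x n : C) : exists c s : C,
  (c * c + n * (s * s) = 1)%C /\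
  (n = 0 -> c = 1) /\ (Cmod n < 1 -> s <> 0) /\
  Cis_series (fun k => RtoC (fact_inv k) * fst (pow_coef x n k))%C (Cexp x * c)%C /\
  Cis_series (fun k => RtoC (fact_inv k) * snd (pow_coef x n k))%C (Cexp x * s)%C.
Proof.
  destruct (Csqrt_exists (- n)) as [s Hs].
  assert (En : n = (- (s * s))%C) by (rewrite Hs; ring).
  destruct (Ceq_dec s 0) as [H0|H0].
  - assert (Hn : n = 0) by (rewrite En, H0; ring). clear En Hs. subst n.
    exists (RtoC 1), (RtoC 1). split; [ring|]. split; [auto|].
    split; [intros _; apply C1_nz|].
    assert (Hc : forall k, fst (pow_coef x 0 k) = (x ^ k)%C).
    { induction k; simpl; [reflexivity|].
      destruct (pow_coef x 0 k) as [p q]; simpl in *. rewrite IHk. ring. }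
    assert (Hd : forall k, snd (pow_coef x 0 (S k)) = (RtoC (INR (S k)) * x ^ k)%C).
    { induction k.
      - simpl. ring.
      - replace (snd (pow_coef x 0 (S (S k))))
          with (fst (pow_coef x 0 (S k)) + x * snd (pow_coef x 0 (S k)))%C
          by (rewrite (surjective_pairing (pow_coef x 0 (S k))); reflexivity || (simpl; destruct (pow_coef x 0 k); reflexivity)).
        rewrite IHk, Hc, (S_INR (S k)), RtoC_plus. rewrite (Cpow_S x k). ring. }
    rewrite !Cmult_1_r. split.
    + apply Cis_series_ext with (2 := Cexp_series x). intros k. rewrite Hc. reflexivity.
    + pose proof (Cexp_series x) as [H1 H2].
      assert (Hk : forall k, (RtoC (fact_inv (S k)) * snd (pow_coef x 0 (S k))
                       = RtoC (fact_inv k) * x ^ k)%C).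
      { intros k. rewrite Hd, <- (fact_inv_S k), RtoC_mult. ring. }
      split.
      * apply (is_series_decr_1 (V := R_NormedModule)).
        replace (plus _ _) with (Re (Cexp x)).
        -- revert H1. apply is_series_ext. intros k. rewrite Hk. reflexivity.
        -- unfold plus, opp, Re; simpl. ring.
      * apply (is_series_decr_1 (V := R_NormedModule)).
        replace (plus _ _) with (Im (Cexp x)).
        -- revert H2. apply is_series_ext. intros k. rewrite Hk. reflexivity.
        -- unfold plus, opp, Im; simpl. ring.
  - set (e := Cexp s). set (e' := Cexp (- s)).
    assert (Hee : (e * e' = 1)%C).
    { unfold e, e'. rewrite <- Cexp_plus. replace (s + - s)%C with (RtoC 0) by ring.
      apply Cexp_0. }
    exists (/ 2 * (e + e'))%C, (/ (2 * s) * (e - e'))%C.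
    assert (Hcs : forall k, (2 * fst (pow_coef x n k) = (x + s) ^ k + (x + - s) ^ k)%C /\
                     (2 * s * snd (pow_coef x n k) = (x + s) ^ k - (x + - s) ^ k)%C).
    { induction k; simpl; [split; ring|].
      destruct (pow_coef x n k) as [p q]; simpl in *. destruct IHk as [I1 I2]. split.
      - transitivity (x * (2 * p) + s * (2 * s * q))%C; [rewrite En; ring|].
        rewrite I1, I2. ring.
      - transitivity (s * (2 * p) + x * (2 * s * q))%C; [ring|].
        rewrite I1, I2. ring. }
    split; [|split; [|split; [|split]]].
    + transitivity (e * e')%C; [|exact Hee]. rewrite En. field. repeat split; assumption.
    + intros E. exfalso. rewrite E in En.
      apply (Cmult_neq_0 s s H0 H0). rewrite Hs, E. ring.
    + intros Hn E. assert (Hs1 : Cmod s < 1).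
      { assert (Hm : Cmod s * Cmod s < 1) by (rewrite <- Cmod_mult, Hs, Cmod_opp; exact Hn).
        pose proof (Cmod_ge_0 s). nra. }
      apply (Cexp_opp_neq s H0 Hs1). apply Ceq_minus. fold e e'.
      transitivity (2 * s * (/ (2 * s) * (e - e')))%C; [field; repeat split; assumption|].
      rewrite E. ring.
    + replace (Cexp x * (/ 2 * (e + e')))%C
        with (/ 2 * (Cexp (x + s) + Cexp (x + - s)))%C by (rewrite !Cexp_plus; unfold e, e'; ring).
      apply Cis_series_ext with (2 := Cis_series_mult _ _ (/ 2)%C
        (Cis_series_plus _ _ _ _ (Cexp_series (x + s)%C) (Cexp_series (x + - s)%C))).
      intros k. destruct (Hcs k) as [I1 _].
      transitivity (RtoC (fact_inv k) * (/ 2 * ((x + s) ^ k + (x + - s) ^ k)))%C; [ring|].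
      rewrite <- I1. field.
    + replace (Cexp x * (/ (2 * s) * (e - e')))%C
        with (/ (2 * s) * (Cexp (x + s) + RtoC (-1) * Cexp (x + - s)))%C
        by (rewrite !Cexp_plus; unfold e, e'; ring).
      apply Cis_series_ext with (2 := Cis_series_mult _ _ (/ (2 * s))%C
        (Cis_series_plus _ _ _ _ (Cexp_series (x + s)%C)
           (Cis_series_mult _ _ (RtoC (-1)) (Cexp_series (x + - s)%C)))).
      intros k. destruct (Hcs k) as [_ I2].
      transitivity (RtoC (fact_inv k) * (/ (2 * s) * ((x + s) ^ k - (x + - s) ^ k)))%C; [ring|].
      rewrite <- I2. field. repeat split; assumption.
Qed.

(** * Quaternions on a slice *)

Ltac qunf := unfold slice_pt, qconj, qvec, qreal, qi, qj, qk, qnorm2, qadd, qopp, qscal,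
  qmul, mkq, q_re, q_i, q_j, q_k, plus, opp, scal, mult, Re, Im in *; simpl in *;
  repeat (progress unfold prod_plus, prod_opp, prod_scal, plus, opp, scal, mult in *;
          simpl in *).

Ltac pair_eq := repeat lazymatch goal with
  | |- (_, _) = (_, _) => apply f_equal2 end.

Ltac quat_ring := intros; 
  repeat match goal with q : quat |- _ => destruct q as [[[? ?] ?] ?] 
    | c : C |- _ => destruct c as [? ?] end;
  qunf; pair_eq; ring.

Lemma quat_eq (p q : quat) :
  q_re p = q_re q -> q_i p = q_i q -> q_j p = q_j q -> q_k p = q_k q -> p = q.
Proof.
  destruct p as [[[a b] c] d], q as [[[a' b'] c'] d'].
  unfold q_re, q_i, q_j, q_k; simpl. intros; subst; reflexivity.
Qed.

Lemma qmul_assoc (p q r : quat) : (p * (q * r) = p * q * r)%Q.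
Proof. quat_ring. Qed.
Lemma qmul_addr (p q r : quat) : (p * (q + r) = p * q + p * r)%Q.
Proof. quat_ring. Qed.
Lemma qmul_1l (p : quat) : (qreal 1 * p = p)%Q.
Proof. quat_ring. Qed.
Lemma qmul_1r (p : quat) : (p * qreal 1 = p)%Q.
Proof. quat_ring. Qed.

Lemma qnorm2_eq_0 (p : quat) : qnorm2 p = 0 -> p = qreal 0.
Proof.
  unfold qnorm2. intros H.
  assert (Hs : forall x, x ^ 2 = 0 -> x = 0).
  { intros x Hx. apply Rsqr_0_uniq. unfold Rsqr. lra. }
  pose proof (pow2_ge_0 (q_re p)). pose proof (pow2_ge_0 (q_i p)).
  pose proof (pow2_ge_0 (q_j p)). pose proof (pow2_ge_0 (q_k p)).
  apply quat_eq; apply Hs; lra.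
Qed.

Lemma qinv_r (p : quat) : p <> qreal 0 -> (p * qinv p = qreal 1)%Q.
Proof.
  intros Hp. assert (H : qnorm2 p <> 0) by (intros E; apply Hp, qnorm2_eq_0, E).
  unfold qinv. destruct p as [[[a b] c] d].
  replace (qreal 1) with (qscal (/ qnorm2 (a, b, c, d)) (qreal (qnorm2 (a, b, c, d)))).
  - generalize (/ qnorm2 (a, b, c, d)). intros k. quat_ring.
  - qunf. pair_eq; field; intros E; apply H; rewrite <- E; ring.
Qed.

Lemma qinv_l (p : quat) : p <> qreal 0 -> (qinv p * p = qreal 1)%Q.
Proof.
  intros Hp. rewrite <- (qinv_r p Hp). unfold qinv.
  generalize (/ qnorm2 p). intros k. quat_ring.
Qed.

(** The complex number [c] read in the plane spanned by 1 and [J]; for an imaginary unit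
    [J] this is a ring embedding of [C]. *)
Definition in_plane (J : quat) (c : C) : quat := slice_pt J (Re c) (Im c).

Lemma in_plane_plus J c d : in_plane J (c + d)%C = (in_plane J c + in_plane J d)%Q.
Proof. unfold in_plane. quat_ring. Qed.

Lemma in_plane_minus J c d : in_plane J (c - d)%C = (in_plane J c - in_plane J d)%Q.
Proof. unfold in_plane. quat_ring. Qed.

Lemma in_plane_mult J c d : imag_unit J ->
  in_plane J (c * d)%C = (in_plane J c * in_plane J d)%Q.
Proof.
  intros HJ. destruct c as [a b], d as [c d].
  transitivity (slice_pt J (a * c) (a * d + b * c) + qscal (b * d) (J * J))%Q.
  - rewrite HJ. unfold in_plane. quat_ring.
  - unfold in_plane. quat_ring.
Qed.

Lemma imag_unit_opp J : imag_unit J -> imag_unit (- J)%Q.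
Proof. unfold imag_unit. intros <-. quat_ring. Qed.

Lemma imag_unit_qi : imag_unit qi.
Proof. unfold imag_unit. quat_ring. Qed.
Lemma imag_unit_qj : imag_unit qj.
Proof. unfold imag_unit. quat_ring. Qed.

Lemma imag_unit_coord J : imag_unit J -> q_re J = 0 /\ qnorm2 J = 1.
Proof.
  destruct J as [[[a b] c] d]. unfold imag_unit. intros H. qunf.
  injection H as H1 H2 H3 H4.
  assert (Ha : a = 0).
  { destruct (Req_dec a 0) as [|Hn]; [assumption|exfalso].
    assert (b = 0) by (apply Rmult_eq_reg_l with a; lra).
    assert (c = 0) by (apply Rmult_eq_reg_l with a; lra).
    assert (d = 0) by (apply Rmult_eq_reg_l with a; lra).
    subst. nra. }
  subst a. split; [reflexivity|lra].
Qed.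

(** Conjugation by [A] moves the plane of [K] to the plane of [J]; this is the mechanism
    of the star product, which evaluates its second factor on the plane of
    [qinv A * J * A]. *)
Lemma intertwine (A J K : quat) (c : C) : (A * K = J * A)%Q ->
  (A * in_plane K c = in_plane J c * A)%Q.
Proof.
  intros H. transitivity (qscal (Re c) A + qscal (Im c) (A * K))%Q.
  - unfold in_plane. quat_ring.
  - rewrite H. unfold in_plane. quat_ring.
Qed.

Lemma conj_imag_unit (A J : quat) : A <> qreal 0 -> imag_unit J ->
  imag_unit (qinv A * J * A)%Q.
Proof.
  unfold imag_unit. intros HA HJ.
  transitivity (qinv A * (J * (A * qinv A) * J) * A)%Q.
  - rewrite !qmul_assoc. reflexivity.
  - rewrite qinv_r, qmul_1r, HJ by exact HA.
    transitivity (qscal (-1) (qinv A * A))%Q; [|rewrite qinv_l by exact HA].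
    + generalize (qinv A). quat_ring.
    + quat_ring.
Qed.

Lemma conj_slice_pt (A J : quat) a b : A <> qreal 0 ->
  (qinv A * slice_pt J a b * A)%Q = slice_pt (qinv A * J * A)%Q a b.
Proof.
  intros HA.
  transitivity (qscal a (qinv A * A) + qscal b (qinv A * J * A))%Q.
  - generalize (qinv A). quat_ring.
  - rewrite qinv_l by exact HA. generalize (qinv A * J * A)%Q. quat_ring.
Qed.

(** A stem value [F0 + sqrt(-1) F1] is a quaternion with complex coefficients:
    [stem_coord p] is its coefficient along the axis of the projection [p], and [vnorm] the
    complex sum of squares of its vector part. *)
Definition stem_coord (p : quat -> R) (F0 F1 : quat) : C := (p F0, p F1).
Definition vnorm (F0 F1 : quat) : C :=
  (stem_coord q_i F0 F1 * stem_coord q_i F0 F1 + stem_coord q_j F0 F1 * stem_coord q_j F0 F1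
   + stem_coord q_k F0 F1 * stem_coord q_k F0 F1)%C.

(** The star product of a stem value [x + V] with its own vector part, read on a slice:
    it is [(x + V) * V = x V - vnorm]. *)
Lemma stem_vec_mul (F0 F1 J : quat) : imag_unit J ->
  ((F0 + J * F1) * qvec F0 + J * ((F0 + J * F1) * qvec F1)
   = in_plane J (stem_coord q_re F0 F1) * (qvec F0 + J * qvec F1)
     - in_plane J (vnorm F0 F1))%Q.
Proof.
  intros HJ.
  transitivity (F0 * qvec F0 + J * J * (F1 * qvec F1) + J * (F1 * qvec F0 + F0 * qvec F1))%Q.
  { quat_ring. }
  transitivity (qscal (q_re F0) (qvec F0) + qscal (q_re F1) (J * J * qvec F1)
    + J * (qscal (q_re F1) (qvec F0) + qscal (q_re F0) (qvec F1))
    - in_plane J (vnorm F0 F1))%Q.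
  - rewrite HJ. unfold in_plane, vnorm, stem_coord. quat_ring.
  - generalize (in_plane J (vnorm F0 F1)). unfold in_plane, stem_coord. quat_ring.
Qed.

Lemma stem_split (F0 F1 J : quat) :
  (F0 + J * F1 = in_plane J (stem_coord q_re F0 F1) + (qvec F0 + J * qvec F1))%Q.
Proof. unfold in_plane, stem_coord. quat_ring. Qed.

(** Star powers follow the recursion of [pow_coef]: on every slice the star product
    with [f] acts as multiplication by [x + V] on the pairs [p + q V], where [x] and [V] are
    the complexified real and vector parts of [f]. *)
Lemma star_pow_slice (f : quat -> quat) (F0 F1 : quat) (a b : R) :
  (forall J, imag_unit J -> f (slice_pt J a b) = (F0 + J * F1)%Q) ->
  forall k J, imag_unit J ->
  star_pow f k (slice_pt J a b)
  = (in_plane J (fst (pow_coef (stem_coord q_re F0 F1) (vnorm F0 F1) k))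
     + in_plane J (snd (pow_coef (stem_coord q_re F0 F1) (vnorm F0 F1) k))
       * (qvec F0 + J * qvec F1))%Q.
Proof.
  intros Hf. set (x := stem_coord q_re F0 F1). set (n := vnorm F0 F1).
  induction k as [|k IH]; intros J HJ.
  - simpl. unfold in_plane. generalize (qvec F0 + J * qvec F1)%Q. quat_ring.
  - cbn [star_pow pow_coef]. destruct (pow_coef x n k) as [p q] eqn:E.
    cbn [fst snd] in *.
    set (A := (F0 + J * F1)%Q).
    transitivity (in_plane J p * A + in_plane J q * (A * qvec F0 + J * (A * qvec F1)))%Q.
    + unfold star. rewrite (Hf J HJ). fold A.
      destruct (quat_eq_dec A (qreal 0)) as [->|HA].
      { generalize (qvec F0), (qvec F1), (in_plane J p), (in_plane J q). quat_ring. }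
      rewrite conj_slice_pt by exact HA.
      set (K := (qinv A * J * A)%Q).
      assert (HK : imag_unit K) by (apply conj_imag_unit; assumption).
      assert (HAK : (A * K = J * A)%Q).
      { unfold K. rewrite !qmul_assoc, qinv_r, qmul_1l by exact HA. reflexivity. }
      rewrite (IH K HK), !qmul_addr, (qmul_assoc A (in_plane K q)),
        (qmul_assoc A (in_plane K q)), !(intertwine A J K) by exact HAK.
      rewrite (qmul_assoc _ K), <- (qmul_assoc _ A K), HAK, <- !qmul_assoc. reflexivity.
    + unfold A. rewrite stem_vec_mul by exact HJ. rewrite (stem_split F0 F1 J). fold x n.
      rewrite in_plane_minus, in_plane_plus, !in_plane_mult by exact HJ.
      assert (Hc : forall c d, (in_plane J c * in_plane J d = in_plane J d * in_plane J c)%Q).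
      { intros c d. rewrite <- !in_plane_mult by exact HJ. rewrite Cmult_comm. reflexivity. }
      rewrite (Hc x p), (Hc n q), (Hc x q).
      generalize (in_plane J x), (in_plane J p), (in_plane J q), (in_plane J n),
        (qvec F0 + J * qvec F1)%Q.
      quat_ring.
Qed.

Lemma qSeries_slice (J w : quat) (u v : nat -> C) (A B : C) :
  Cis_series (fun k => RtoC (fact_inv k) * u k)%C A ->
  Cis_series (fun k => RtoC (fact_inv k) * v k)%C B ->
  qSeries (fun k => qscal (/ INR (fact k)) (in_plane J (u k) + in_plane J (v k) * w)%Q)
  = (in_plane J A + in_plane J B * w)%Q.
Proof.
  intros [H1 H2] [H3 H4].
  assert (H : forall c1 c2 c3 c4 (s : nat -> R),
    (forall k, s k = / INR (fact k) * (c1 * Re (u k) + c2 * Im (u k) + c3 * Re (v k) + c4 * Im (v k))) ->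
    Series s = c1 * Re A + c2 * Im A + c3 * Re B + c4 * Im B).
  { intros c1 c2 c3 c4 s Hs. apply is_series_unique.
    apply (is_series_ext (fun k => c1 * Re (RtoC (fact_inv k) * u k)%C
      + c2 * Im (RtoC (fact_inv k) * u k)%C + c3 * Re (RtoC (fact_inv k) * v k)%C
      + c4 * Im (RtoC (fact_inv k) * v k)%C)).
    - intros k. rewrite Hs. unfold fact_inv, Re, Im; simpl. ring.
    - repeat apply is_series_Rplus; apply is_series_Rscal; assumption. }
  destruct J as [[[j0 j1] j2] j3], w as [[[w0 w1] w2] w3].
  unfold qSeries.
  apply quat_eq; unfold mkq; [unfold q_re at 1|unfold q_i at 1|unfold q_j at 1|unfold q_k at 1];
    cbn [fst snd].
  - rewrite (H 1 j0 w0 (j0 * w0 - j1 * w1 - j2 * w2 - j3 * w3)).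
    + unfold in_plane. destruct A, B. qunf. ring.
    + intros k. unfold in_plane. destruct (u k), (v k). qunf. ring.
  - rewrite (H 0 j1 w1 (j0 * w1 + j1 * w0 + j2 * w3 - j3 * w2)).
    + unfold in_plane. destruct A, B. qunf. ring.
    + intros k. unfold in_plane. destruct (u k), (v k). qunf. ring.
  - rewrite (H 0 j2 w2 (j0 * w2 - j1 * w3 + j2 * w0 + j3 * w1)).
    + unfold in_plane. destruct A, B. qunf. ring.
    + intros k. unfold in_plane. destruct (u k), (v k). qunf. ring.
  - rewrite (H 0 j3 w3 (j0 * w3 + j1 * w2 - j2 * w1 + j3 * w0)).
    + unfold in_plane. destruct A, B. qunf. ring.
    + intros k. unfold in_plane. destruct (u k), (v k). qunf. ring.
Qed.

Lemma Series_qext (a b : nat -> quat) : (forall k, a k = b k) -> qSeries a = qSeries b.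
Proof.
  intros H. unfold qSeries, mkq.
  pair_eq; apply Series_ext; intros k; rewrite H; reflexivity.
Qed.

Theorem exp_star_slice (f : quat -> quat) (F0 F1 : quat) (a b : R) :
  (forall J, imag_unit J -> f (slice_pt J a b) = (F0 + J * F1)%Q) ->
  exists c s : C,
    (c * c + vnorm F0 F1 * (s * s) = 1)%C /\
    (vnorm F0 F1 = 0 -> c = 1) /\ (Cmod (vnorm F0 F1) < 1 -> s <> 0) /\
    forall J, imag_unit J -> exp_star f (slice_pt J a b)
      = (in_plane J (Cexp (stem_coord q_re F0 F1) * c)
         + in_plane J (Cexp (stem_coord q_re F0 F1) * s) * (qvec F0 + J * qvec F1))%Q.
Proof.
  intros Hf.
  destruct (pow_coef_series (stem_coord q_re F0 F1) (vnorm F0 F1))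
    as (c & s & H1 & H2 & H3 & H4 & H5).
  exists c, s. repeat split; try assumption. intros J HJ.
  unfold exp_star. rewrite <- (qSeries_slice J _ _ _ _ _ H4 H5).
  apply Series_qext. intros k. rewrite (star_pow_slice f F0 F1 a b Hf k J HJ). reflexivity.
Qed.

(** Evaluating on the opposite units [qi] and [- qi] separates the two parts of a stem
    value. *)
Lemma stem_ext (P Q P' Q' : quat) :
  (forall J, imag_unit J -> (P + J * Q = P' + J * Q')%Q) -> P = P' /\ Q = Q'.
Proof.
  intros H. pose proof (H _ imag_unit_qi) as H1.
  pose proof (H _ (imag_unit_opp _ imag_unit_qi)) as H2. clear H.
  destruct P as [[[p0 p1] p2] p3], Q as [[[q0 q1] q2] q3],
    P' as [[[p0' p1'] p2'] p3'], Q' as [[[q0' q1'] q2'] q3'].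
  qunf. injection H1 as A0 A1 A2 A3. injection H2 as B0 B1 B2 B3.
  split; pair_eq; lra.
Qed.

(** The value on the slice of [J] of the stem with complex coefficients [c0], [c1],
    [c2], [c3] along 1, i, j, k. *)
Definition stem_of (c0 c1 c2 c3 : C) (J : quat) : quat :=
  (mkq (Re c0) (Re c1) (Re c2) (Re c3) + J * mkq (Im c0) (Im c1) (Im c2) (Im c3))%Q.

Lemma stem_of_inj (c0 c1 c2 c3 d0 d1 d2 d3 : C) :
  (forall J, imag_unit J -> stem_of c0 c1 c2 c3 J = stem_of d0 d1 d2 d3 J) ->
  c0 = d0 /\ c1 = d1 /\ c2 = d2 /\ c3 = d3.
Proof.
  intros H. apply stem_ext in H. destruct H as [H1 H2]. unfold mkq, Re, Im in *.
  injection H1 as A0 A1 A2 A3. injection H2 as B0 B1 B2 B3.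
  repeat split; apply injective_projections; assumption.
Qed.

Lemma stem_of_stem_coord (F0 F1 J : quat) :
  (F0 + J * F1)%Q
  = stem_of (stem_coord q_re F0 F1) (stem_coord q_i F0 F1) (stem_coord q_j F0 F1) (stem_coord q_k F0 F1) J.
Proof. unfold stem_of, stem_coord. quat_ring. Qed.

Lemma in_plane_stem_of (c c0 c1 c2 c3 : C) (J : quat) : imag_unit J ->
  (in_plane J c * stem_of c0 c1 c2 c3 J)%Q
  = stem_of (c * c0)%C (c * c1)%C (c * c2)%C (c * c3)%C J.
Proof.
  intros HJ. destruct c as [a b], c0 as [x0 y0], c1 as [x1 y1], c2 as [x2 y2], c3 as [x3 y3].
  transitivity (qscal a (mkq x0 x1 x2 x3) + qscal b (J * J * mkq y0 y1 y2 y3)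
    + J * (qscal a (mkq y0 y1 y2 y3) + qscal b (mkq x0 x1 x2 x3)))%Q.
  - unfold in_plane, stem_of. quat_ring.
  - rewrite HJ. unfold stem_of. quat_ring.
Qed.

Lemma exp_star_stem_of (F0 F1 J : quat) (c s : C) : imag_unit J ->
  (in_plane J c + in_plane J s * (qvec F0 + J * qvec F1))%Q
  = stem_of c (s * stem_coord q_i F0 F1)%C (s * stem_coord q_j F0 F1)%C (s * stem_coord q_k F0 F1)%C J.
Proof.
  intros HJ.
  assert (E : (qvec F0 + J * qvec F1)%Q
    = stem_of (RtoC 0) (stem_coord q_i F0 F1) (stem_coord q_j F0 F1) (stem_coord q_k F0 F1) J)
    by (unfold stem_of, stem_coord; quat_ring).
  rewrite E, in_plane_stem_of by exact HJ. unfold in_plane, stem_of.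
  generalize (stem_coord q_i F0 F1), (stem_coord q_j F0 F1), (stem_coord q_k F0 F1). quat_ring.
Qed.

(** * The stem domain *)

Lemma slice_pt_coord (J : quat) (a b : R) : imag_unit J ->
  q_re (slice_pt J a b) = a /\ qvec (slice_pt J a b) = qscal b J.
Proof.
  intros HJ. apply imag_unit_coord in HJ. destruct HJ as [H0 _].
  destruct J as [[[j0 j1] j2] j3]. unfold q_re in H0; simpl in H0. subst j0.
  split; [qunf; ring|quat_ring].
Qed.

Lemma qnorm2_scal (k : R) (p : quat) : qnorm2 (qscal k p) = k ^ 2 * qnorm2 p.
Proof. destruct p as [[[a b] c] d]. qunf. ring. Qed.

Lemma qnorm_scal_unit (J : quat) (b : R) : imag_unit J -> qnorm (qscal b J) = Rabs b.
Proof.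
  intros HJ. apply imag_unit_coord in HJ. destruct HJ as [_ H1].
  unfold qnorm. rewrite qnorm2_scal, H1, Rmult_1_r. 
  rewrite <- (pow2_abs b). apply sqrt_pow2, Rabs_pos.
Qed.

Lemma imag_unit_of_coord (J : quat) : q_re J = 0 -> qnorm2 J = 1 -> imag_unit J.
Proof.
  destruct J as [[[a b] c] d]. unfold imag_unit. intros H0 H1.
  unfold q_re in H0; simpl in H0; subst a. qunf. pair_eq; lra.
Qed.

Definition modulus_pt (q : quat) : R * R := (q_re q, qnorm (qvec q)).

(** The imaginary direction of [q], an arbitrary unit on the real axis. *)
Definition axis (q : quat) : quat :=
  if Req_EM_T (qnorm (qvec q)) 0 then qi else qscal (/ qnorm (qvec q)) (qvec q).

Lemma qnorm_pos q : 0 <= qnorm q.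
Proof. apply sqrt_pos. Qed.

Lemma qnorm_sq q : qnorm q ^ 2 = qnorm2 q.
Proof.
  unfold qnorm. rewrite pow2_sqrt; [reflexivity|].
  unfold qnorm2. pose proof (pow2_ge_0 (q_re q)). pose proof (pow2_ge_0 (q_i q)).
  pose proof (pow2_ge_0 (q_j q)). pose proof (pow2_ge_0 (q_k q)). lra.
Qed.

Lemma axis_spec q : imag_unit (axis q) /\
  q = slice_pt (axis q) (q_re q) (qnorm (qvec q)).
Proof.
  unfold axis. destruct (Req_EM_T (qnorm (qvec q)) 0) as [E|E].
  - split; [apply imag_unit_qi|]. rewrite E.
    assert (H : qvec q = qreal 0).
    { apply qnorm2_eq_0. rewrite <- qnorm_sq, E. ring. }
    destruct q as [[[a b] c] d]. unfold qvec, qreal, mkq, q_i, q_j, q_k in H.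
    simpl in H. injection H as -> -> ->. quat_ring.
  - split.
    + apply imag_unit_of_coord.
      * destruct q as [[[a b] c] d]. generalize (/ qnorm (qvec (a, b, c, d))).
        intros k. qunf. ring.
      * rewrite qnorm2_scal, <- qnorm_sq. field. exact E.
    + transitivity (qreal (q_re q) + qscal (/ qnorm (qvec q) * qnorm (qvec q)) (qvec q))%Q.
      * rewrite Rinv_l by exact E. quat_ring.
      * generalize (qnorm (qvec q)), (/ qnorm (qvec q)). quat_ring.
Qed.

Lemma slice_pt_opp J a b : slice_pt (- J)%Q a (- b) = slice_pt J a b.
Proof. quat_ring. Qed.

Lemma continuous_quat {U : UniformSpace} (f0 f1 f2 f3 : U -> R) (x : U) :
  continuous f0 x -> continuous f1 x -> continuous f2 x -> continuous f3 x ->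
  continuous (fun y => mkq (f0 y) (f1 y) (f2 y) (f3 y)) x.
Proof.
  assert (Hp : forall (V W : UniformSpace) (f : U -> V) (g : U -> W),
    continuous f x -> continuous g x -> continuous (fun y => (f y, g y)) x).
  { intros V W f g Hf Hg.
    apply (continuous_comp_2 f g (fun a b => (a, b)) x Hf Hg).
    intros P [e He]. exists e. intros [u v] Huv. apply He. exact Huv. }
  intros H0 H1 H2 H3. unfold mkq.
  apply (Hp (prod_UniformSpace (prod_UniformSpace R_UniformSpace R_UniformSpace) R_UniformSpace)
    R_UniformSpace); [|exact H3].
  apply (Hp (prod_UniformSpace R_UniformSpace R_UniformSpace) R_UniformSpace); [|exact H2].
  apply (Hp R_UniformSpace R_UniformSpace); assumption.
Qed.

Lemma continuous_q_re (q : quat) : continuous q_re q.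
Proof.
  destruct q as [[[a b] c] d].
  apply (continuous_comp (fun q : quat => fst (fst q)) fst); [|apply continuous_fst].
  apply (continuous_comp (fun q : quat => fst q) fst); apply continuous_fst.
Qed.
Lemma continuous_q_i (q : quat) : continuous q_i q.
Proof.
  destruct q as [[[a b] c] d].
  apply (continuous_comp (fun q : quat => fst (fst q)) snd); [|apply continuous_snd].
  apply (continuous_comp (fun q : quat => fst q) fst); apply continuous_fst.
Qed.
Lemma continuous_q_j (q : quat) : continuous q_j q.
Proof.
  destruct q as [[[a b] c] d].
  apply (continuous_comp (fun q : quat => fst q) snd); [apply continuous_fst|apply continuous_snd].
Qed.
Lemma continuous_q_k (q : quat) : continuous q_k q.
Proof. destruct q as [[[a b] c] d]. apply continuous_snd. Qed.

Lemma continuous_modulus_pt (q : quat) : continuous (modulus_pt : quat -> C) q.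
Proof.
  apply continuous_C_pair; [exact (continuous_q_re q)|].
  change (continuous (fun y => sqrt (qnorm2 (qvec y))) q).
  apply (continuous_comp (fun y => qnorm2 (qvec y)) sqrt); [|apply continuous_sqrt].
  apply (continuous_ext (fun y => q_i y * q_i y + q_j y * q_j y + q_k y * q_k y)).
  - intros y. unfold qnorm2, qvec, mkq, q_re, q_i, q_j, q_k; simpl. ring.
  - pose proof (continuous_q_i q) as H1. pose proof (continuous_q_j q) as H2.
    pose proof (continuous_q_k q) as H3.
    exact (continuous_Rplus _ _ _ (continuous_Rplus _ _ _ (continuous_Rmult _ _ _ H1 H1)
      (continuous_Rmult _ _ _ H2 H2)) (continuous_Rmult _ _ _ H3 H3)).
Qed.

(** By circularity, membership does not depend on the imaginary unit. *)
Lemma stem_dom_slice (Omega : quat -> Prop) (HOmega : circular_slice_domain Omega)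
    (z : C) : stem_dom Omega z ->
  forall J, imag_unit J -> Omega (slice_pt J (Re z) (Im z)).
Proof.
  destruct z as [a b]. intros (I & HI & HOm) J HJ. unfold Re, Im in *; simpl in *.
  destruct HOmega as (_ & Hcirc & _). apply (Hcirc _ _ HOm). unfold sphere.
  destruct (slice_pt_coord I a b HI) as [-> ->].
  rewrite qnorm_scal_unit by exact HI.
  destruct (Rle_dec 0 b).
  - exists J. rewrite Rabs_pos_eq by assumption. auto.
  - exists (- J)%Q. rewrite Rabs_left by lra. split; [apply imag_unit_opp, HJ|].
    symmetry. apply slice_pt_opp.
Qed.

Lemma stem_dom_conj (Omega : quat -> Prop) (HOmega : circular_slice_domain Omega)
    (z : C) : stem_dom Omega z -> stem_dom Omega (Cconj z).
Proof.
  intros Hz. exists (- qi)%Q. split; [apply imag_unit_opp, imag_unit_qi|].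
  destruct z as [a b]. simpl. rewrite slice_pt_opp.
  apply (stem_dom_slice Omega HOmega (a, b) Hz), imag_unit_qi.
Qed.

Lemma stem_dom_modulus (Omega : quat -> Prop) (q : quat) : Omega q -> stem_dom Omega (modulus_pt q).
Proof.
  intros Hq. destruct (axis_spec q) as [H1 H2]. exists (axis q). split; [exact H1|].
  unfold modulus_pt; simpl. rewrite <- H2. exact Hq.
Qed.

Lemma stem_dom_open (Omega : quat -> Prop) (HOmega : circular_slice_domain Omega) : open (stem_dom Omega : C -> Prop).
Proof.
  intros z Hz. pose proof (stem_dom_slice Omega HOmega z Hz qi imag_unit_qi) as Hq.
  destruct HOmega as ((_ & _ & Hopen) & _).
  assert (Hc : continuous (fun w : C => mkq (Re w) (Im w) 0 0) z).
  { apply continuous_quat; try apply continuous_const;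
    [apply continuous_Re|apply continuous_Im]; apply continuous_id. }
  assert (E : forall w : C, slice_pt qi (Re w) (Im w) = mkq (Re w) (Im w) 0 0)
    by quat_ring.
  rewrite E in Hq. pose proof (Hc _ (Hopen _ Hq)) as HL. unfold filtermap in HL.
  revert HL. apply filter_imp. intros w Hw. exists qi. split; [apply imag_unit_qi|].
  rewrite <- E in Hw. exact Hw.
Qed.

(** The values of [d] are integer multiples of [PI], and [d] vanishes at the real points
    by oddness.  Pulled back to [Omega] along [modulus_pt], the sets [Rabs d < 1] and
    [Rabs d > 1] are open and cover [Omega], and the first contains a real point, so
    connectedness leaves the second empty. *)
Lemma stem_dom_sin_zero (Omega : quat -> Prop) (HOmega : circular_slice_domain Omega)
    (d : C -> R) :
  (forall z, stem_dom Omega z -> continuous d z) -> (forall z, stem_dom Omega z -> sin (d z) = 0) ->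
  (forall z, stem_dom Omega z -> d (Cconj z) = - d z) -> forall z, stem_dom Omega z -> d z = 0.
Proof.
  intros Hc Hsin Hodd.
  assert (Hsmall : forall z, stem_dom Omega z -> Rabs (d z) <= 1 -> d z = 0).
  { intros z Hz H1. specialize (Hsin z Hz). pose proof PI2_1.
    destruct (Rtotal_order (d z) 0) as [Hn|[H0|Hp]]; [|exact H0|].
    - rewrite Rabs_left in H1 by lra. pose proof (sin_gt_0 (- d z)) as Hg.
      rewrite sin_neg in Hg. lra.
    - rewrite Rabs_pos_eq in H1 by lra. pose proof (sin_gt_0 (d z)). lra. }
  assert (Hcont : forall q, Omega q -> continuous (fun q => Rabs (d (modulus_pt q))) q).
  { intros q Hq. apply (continuous_comp (fun q => d (modulus_pt q)) Rabs).
    - apply (continuous_comp modulus_pt d); [apply continuous_modulus_pt|].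
      apply Hc, stem_dom_modulus, Hq.
    - apply continuity_pt_filterlim, Rcontinuity_abs. }
  pose proof HOmega as ((_ & Hconn & Hopen) & _ & (x & Hx & Hreal)).
  assert (Hq0 : forall q, Omega q -> d (modulus_pt q) = 0).
  { intros q Hq. apply Hsmall; [apply stem_dom_modulus, Hq|].
    destruct (Rle_dec (Rabs (d (modulus_pt q))) 1) as [|Hn]; [assumption|exfalso].
    destruct (Hconn (fun q => Omega q /\ Rabs (d (modulus_pt q)) < 1)
                (fun q => Omega q /\ 1 < Rabs (d (modulus_pt q)))) as (p & _ & H1 & H2).
    - intros p [Hp H1]. apply filter_and; [apply Hopen, Hp|].
      exact (Hcont p Hp _ (open_lt 1 _ H1)).
    - intros p [Hp H1]. apply filter_and; [apply Hopen, Hp|].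
      exact (Hcont p Hp _ (open_gt 1 _ H1)).
    - intros p Hp. destruct (Rlt_dec (Rabs (d (modulus_pt p))) 1); [left; auto|right].
      split; [exact Hp|]. destruct (Req_dec (Rabs (d (modulus_pt p))) 1) as [E|]; [|lra].
      assert (E0 : d (modulus_pt p) = 0)
        by (apply Hsmall; [apply stem_dom_modulus, Hp|lra]).
      rewrite E0, Rabs_R0 in E. lra.
    - exists x. split; [exact Hx|]. split; [exact Hx|].
      pose proof (Hodd _ (stem_dom_modulus Omega x Hx)) as Ho.
      destruct Hreal as [r ->].
      assert (E : Cconj (modulus_pt (qreal r)) = modulus_pt (qreal r)).
      { unfold modulus_pt, Cconj. simpl. f_equal.
        assert (Hz : qnorm2 (qvec (qreal r)) = 0) by (qunf; ring).
        unfold qnorm. rewrite Hz, sqrt_0. ring. }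
      rewrite E in Ho. replace (d (modulus_pt (qreal r))) with 0 by lra.
      rewrite Rabs_R0. lra.
    - exists q. split; [exact Hq|]. split; [exact Hq|lra].
    - lra. }
  intros z Hz. pose proof (stem_dom_slice Omega HOmega z Hz qi imag_unit_qi) as Hq.
  pose proof (Hq0 _ Hq) as H. destruct z as [a b]. unfold Re, Im in *; simpl in *.
  unfold modulus_pt in H. destruct (slice_pt_coord qi a b imag_unit_qi) as [E1 E2].
  rewrite E1, E2, qnorm_scal_unit in H by apply imag_unit_qi.
  destruct (Rle_dec 0 b).
  - rewrite Rabs_pos_eq in H by assumption. exact H.
  - rewrite Rabs_left in H by lra. pose proof (Hodd _ Hz) as Ho.
    unfold Cconj in Ho; simpl in Ho. rewrite H in Ho. lra.
Qed.

(** * Stem functions as holomorphic functions *)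

Lemma is_linear_q_re : is_linear (q_re : quat -> R).
Proof.
  apply (is_linear_comp (fun q : quat => fst (fst q)) fst); [|apply is_linear_fst].
  apply (is_linear_comp (fun q : quat => fst q) fst); apply is_linear_fst.
Qed.
Lemma is_linear_q_i : is_linear (q_i : quat -> R).
Proof.
  apply (is_linear_comp (fun q : quat => fst (fst q)) snd); [|apply is_linear_snd].
  apply (is_linear_comp (fun q : quat => fst q) fst); apply is_linear_fst.
Qed.
Lemma is_linear_q_j : is_linear (q_j : quat -> R).
Proof.
  apply (is_linear_comp (fun q : quat => fst q) snd); [apply is_linear_fst|apply is_linear_snd].
Qed.
Lemma is_linear_q_k : is_linear (q_k : quat -> R).
Proof. apply is_linear_snd. Qed.

Lemma is_derive_linear (p : quat -> R) (f : R -> quat) (x : R) (l : quat) :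
  is_linear p -> is_derive f x l -> is_derive (fun t => p (f t)) x (p l).
Proof.
  intros Hp Hf. unfold is_derive.
  apply filterdiff_ext_lin with (fun t => p (scal t l)).
  - apply (filterdiff_comp' f p); [exact Hf|]. apply filterdiff_linear, Hp.
  - intros t. apply (linear_scal p Hp).
Qed.

Lemma is_derive_pair {V W : NormedModule R_AbsRing} (f : R -> V) (g : R -> W)
    (x : R) (l : V) (m : W) :
  is_derive f x l -> is_derive g x m ->
  is_derive (fun t => (f t, g t)) x (l, m).
Proof.
  intros Hf Hg. unfold is_derive.
  apply filterdiff_ext_lin with (fun t => (scal t l, scal t m)).
  - apply (filterdiff_comp'_2 f g (fun a b => (a, b)) x
      (fun t => scal t l) (fun t => scal t m) (fun a b => (a, b))); try assumption.
    apply filterdiff_linear. apply is_linear_prod; [apply is_linear_fst|apply is_linear_snd].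
  - intros t. reflexivity.
Qed.

Lemma is_derive_mkq (f0 f1 f2 f3 : R -> R) (x l0 l1 l2 l3 : R) :
  is_derive f0 x l0 -> is_derive f1 x l1 -> is_derive f2 x l2 -> is_derive f3 x l3 ->
  is_derive (fun t => mkq (f0 t) (f1 t) (f2 t) (f3 t)) x (mkq l0 l1 l2 l3).
Proof.
  intros H0 H1 H2 H3. unfold mkq. repeat apply is_derive_pair; assumption.
Qed.

Lemma Cderiv_of_littleo (f : C -> C) (z l : C) :
  (forall e, 0 < e -> locally z (fun w =>
     Cmod (f w - f z - l * (w - z)) <= e * Cmod (w - z))) ->
  Cderiv f z l.
Proof.
  intros H.
  exists (fun w => if Ceq_dec w z then l else (f w - f z) / (w - z))%C.
  destruct (Ceq_dec z z) as [_|]; [|congruence].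
  split; [|split; [reflexivity|]].
  - apply continuous_disc. intros e He.
    destruct (proj1 (locally_disc z _) (H (e / 2) ltac:(lra))) as (d & Hd & Hw).
    exists d. split; [exact Hd|]. intros w Hwd. specialize (Hw w Hwd).
    destruct (Ceq_dec z z) as [_|]; [|congruence].
    destruct (Ceq_dec w z) as [->|Hn].
    + replace (l - l)%C with (RtoC 0) by ring. rewrite Cmod_0. exact He.
    + assert (Hn' : (w - z)%C <> 0) by (intros E; apply Hn, Ceq_minus, E).
      replace ((f w - f z) / (w - z) - l)%C
        with ((f w - f z - l * (w - z)) / (w - z))%C by (field; exact Hn').
      rewrite Cmod_div by exact Hn'.
      assert (Hp : 0 < Cmod (w - z)) by (apply Cmod_gt_0, Hn').
      apply Rle_lt_trans with (e / 2); [|lra].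
      apply Rmult_le_reg_r with (Cmod (w - z)); [exact Hp|].
      unfold Rdiv at 1. rewrite Rmult_assoc, Rinv_l, Rmult_1_r by lra. exact Hw.
  - apply filter_forall. intros w. toC. destruct (Ceq_dec w z) as [->|Hn].
    + ring.
    + field. intros E. apply Hn, Ceq_minus, E.
Qed.

Lemma differential_of_partials (u ua ub : C -> R) (z : C) :
  locally z (fun w => is_derive (fun t => u (t, Im w)) (Re w) (ua w)) ->
  is_derive (fun t => u (Re z, t)) (Im z) (ub z) -> continuous ua z ->
  forall e, 0 < e -> locally z (fun w =>
    Rabs (u w - u z - (Re (w - z)%C * ua z + Im (w - z)%C * ub z)) <= e * Cmod (w - z)).
Proof.
  destruct z as [x y]. intros H1 H2 H3 e He.
  assert (Hd : filterdiff (fun w : R * R => u (fst w, snd w)) (locally (x, y))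
    (fun w => plus (scal (fst w) (ua (x, y))) (scal (snd w) (ub (x, y))))).
  { apply (is_derive_filterdiff (fun a b => u (a, b)) x y (fun a b => ua (a, b)) (ub (x, y))).
    - revert H1. apply filter_imp. intros [a b] H. exact H.
    - exact H2.
    - apply (continuous_ext ua); [|exact H3]. intros [a b]. reflexivity. }
  destruct Hd as [_ Hd].
  specialize (Hd (x, y) (fun P HP => HP) (mkposreal e He)).
  revert Hd. apply filter_imp. intros [a b] H.
  assert (En : Cmod ((a, b) - (x, y)) = norm (minus (a, b) (x, y) : prod_NormedModule _ R_NormedModule R_NormedModule)).
  { unfold Cmod. unfold norm; simpl. unfold prod_norm, norm; simpl.
    unfold abs, minus, plus, opp; simpl. unfold plus, opp; simpl.
    change (sqrt ((a + - x) ^ 2 + (b + - y) ^ 2)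
      = sqrt (Rabs (a + - x) ^ 2 + Rabs (b + - y) ^ 2)).
    rewrite !pow2_abs. reflexivity. }
  rewrite En. simpl in H. unfold norm in H at 1; simpl in H. unfold abs in H; simpl in H.
  replace (u (a, b) - u (x, y) - (Re ((a, b) - (x, y))%C * ua (x, y) + Im ((a, b) - (x, y))%C * ub (x, y)))
    with (minus (minus (u (a, b)) (u (x, y)))
      (plus (scal (a + - x) (ua (x, y))) (scal (b + - y) (ub (x, y)))));
    [exact H|].
  unfold minus, plus, opp, scal; simpl. unfold mult; simpl. unfold Re, Im; simpl. ring.
Qed.

(** Continuous partial derivatives make [u] and [v] differentiable, and the
    Cauchy-Riemann equations say that the real differential is a complex multiplication. *)
Lemma hol_of_partials (D : C -> Prop) (u v ua ub va vb : C -> R) : open D ->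
  (forall a b, D (a, b) ->
     (is_derive (fun t => u (t, b)) a (ua (a, b)) /\
      is_derive (fun t => u (a, t)) b (ub (a, b))) /\
     (is_derive (fun t => v (t, b)) a (va (a, b)) /\
      is_derive (fun t => v (a, t)) b (vb (a, b))) /\
     continuous ua (a, b) /\ continuous va (a, b) /\
     ua (a, b) = vb (a, b) /\ ub (a, b) = - va (a, b)) ->
  hol D (fun z => (u z, v z)).
Proof.
  intros HO H. exists (fun z => (ua z, va z)). intros [a b] Hz.
  destruct (H a b Hz) as ((Hua & Hub) & (Hva & Hvb) & Cu & Cv & E1 & E2).
  split; [|apply continuous_C_pair; assumption].
  apply Cderiv_of_littleo. intros e He.
  assert (Lu : locally ((a, b) : C) (fun w => is_derive (fun t => u (t, Im w)) (Re w) (ua w))).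
  { generalize (HO _ Hz). apply filter_imp. intros [x y] Hw. apply H, Hw. }
  assert (Lv : locally ((a, b) : C) (fun w => is_derive (fun t => v (t, Im w)) (Re w) (va w))).
  { generalize (HO _ Hz). apply filter_imp. intros [x y] Hw. apply H, Hw. }
  pose proof (differential_of_partials u ua ub (a, b) Lu Hub Cu (e / 2) ltac:(lra)) as Du.
  pose proof (differential_of_partials v va vb (a, b) Lv Hvb Cv (e / 2) ltac:(lra)) as Dv.
  generalize (filter_and _ _ Du Dv). apply filter_imp. intros w [B1 B2].
  apply Rle_trans with (1 := Cmod_le_sum _).
  rewrite E2 in B1. rewrite <- E1 in B2.
  match goal with |- Rabs ?r + Rabs ?i <= _ =>
    replace r with (u w - u (a, b) - (Re (w - (a, b))%C * ua (a, b) + Im (w - (a, b))%C * - va (a, b)));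
    [replace i with (v w - v (a, b) - (Re (w - (a, b))%C * va (a, b) + Im (w - (a, b))%C * ua (a, b)))|]
  end; [lra| |]; unfold Re, Im; simpl; ring.
Qed.

Lemma partials_of_Cderiv (f : C -> C) (a b : R) (l : C) : Cderiv f (a, b) l ->
  (is_derive (fun t => Re (f (t, b))) a (Re l) /\ is_derive (fun t => Im (f (t, b))) a (Im l)) /\
  (is_derive (fun t => Re (f (a, t))) b (- Im l) /\ is_derive (fun t => Im (f (a, t))) b (Re l)).
Proof.
  intros H. split.
  - destruct (Cderiv_curve f (fun t => (t, b)) a l (RtoC 1) H) as [H1 H2].
    + split; unfold Re, Im; simpl; auto_derive; auto.
    + rewrite Cmult_1_r in H1, H2. split; assumption.
  - destruct (Cderiv_curve f (fun t => (a, t)) b l Ci H) as [H1 H2].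
    + split; unfold Re, Im; simpl; auto_derive; auto.
    + replace (Re (l * Ci)%C) with (- Im l) in H1 by (unfold Re, Im; simpl; ring).
      replace (Im (l * Ci)%C) with (Re l) in H2 by (unfold Re, Im; simpl; ring).
      split; assumption.
Qed.

Lemma hol_stem_coord (Omega : quat -> Prop) (F0 F1 : R * R -> quat) (p : quat -> R) :
  circular_slice_domain Omega -> holomorphic_stem Omega F0 F1 -> is_linear p ->
  hol (stem_dom Omega) (fun z => stem_coord p (F0 z) (F1 z)).
Proof.
  intros HOm (_ & F0a & F0b & F1a & F1b & H0 & H1 & HCR) Hp.
  assert (Hpc : forall (G : R * R -> quat) (z : C), continuous G z -> continuous (fun w : C => p (G w)) z).
  { intros G z HG. apply (continuous_comp G p); [exact HG|]. apply (linear_cont p _ Hp). }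
  unfold stem_coord.
  apply (hol_of_partials (stem_dom Omega) (fun z => p (F0 z)) (fun z => p (F1 z))
    (fun z => p (F0a z)) (fun z => p (F0b z)) (fun z => p (F1a z)) (fun z => p (F1b z))
    (stem_dom_open Omega HOm)).
  intros a b Hab. destruct (H0 a b Hab) as (A1 & A2 & A3 & A4).
  destruct (H1 a b Hab) as (B1 & B2 & B3 & B4). destruct (HCR _ Hab) as [E1 E2].
  split; [|split; [|split; [|split; [|split]]]].
  - split; apply (is_derive_linear p); assumption.
  - split; apply (is_derive_linear p); assumption.
  - apply Hpc; assumption.
  - apply Hpc; assumption.
  - rewrite E1. reflexivity.
  - rewrite E2. apply (linear_opp p _ Hp).
Qed.

Lemma stem_coord_conj (Omega : quat -> Prop) (F0 F1 : R * R -> quat) (p : quat -> R) :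
  holomorphic_stem Omega F0 F1 -> is_linear p -> forall z : C, stem_dom Omega z ->
  stem_coord p (F0 (Cconj z)) (F1 (Cconj z)) = Cconj (stem_coord p (F0 z) (F1 z)).
Proof.
  intros (Hsym & _) Hp [a b] Hz. destruct (Hsym a b Hz) as [E0 E1].
  unfold Cconj; simpl. rewrite E0, E1. unfold stem_coord; simpl.
  f_equal. apply (linear_opp p _ Hp).
Qed.

Ltac pcont := lazymatch goal with
  | |- continuous (fun y => - Im (?f y)) ?x =>
      apply (continuous_Ropp (fun y => Im (f y)) x), (continuous_Im f x); assumption
  | |- continuous (fun y => Im (?f y)) ?x => apply (continuous_Im f x); assumption
  | |- continuous (fun y => Re (?f y)) ?x => apply (continuous_Re f x); assumption
  end.

Lemma stem_of_hol (Omega : quat -> Prop) (g0 g1 g2 g3 : C -> C) :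
  circular_slice_domain Omega ->
  (forall g, g = g0 \/ g = g1 \/ g = g2 \/ g = g3 ->
     hol (stem_dom Omega) g /\
     forall z, stem_dom Omega z -> g (Cconj z) = Cconj (g z)) ->
  holomorphic_stem Omega
    (fun z => mkq (Re (g0 z)) (Re (g1 z)) (Re (g2 z)) (Re (g3 z)))
    (fun z => mkq (Im (g0 z)) (Im (g1 z)) (Im (g2 z)) (Im (g3 z))).
Proof.
  intros HOm H.
  destruct (H g0) as ((d0 & D0) & S0); [tauto|].
  destruct (H g1) as ((d1 & D1) & S1); [tauto|].
  destruct (H g2) as ((d2 & D2) & S2); [tauto|].
  destruct (H g3) as ((d3 & D3) & S3); [tauto|]. clear H.
  split.
  - intros a b Hz. pose proof (S0 _ Hz) as T0. pose proof (S1 _ Hz) as T1.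
    pose proof (S2 _ Hz) as T2. pose proof (S3 _ Hz) as T3.
    unfold Cconj in T0, T1, T2, T3; simpl in *. rewrite T0, T1, T2, T3.
    split; [reflexivity|]. unfold Re, Im; simpl. quat_ring.
  - exists (fun z => mkq (Re (d0 z)) (Re (d1 z)) (Re (d2 z)) (Re (d3 z))),
      (fun z => mkq (- Im (d0 z)) (- Im (d1 z)) (- Im (d2 z)) (- Im (d3 z))),
      (fun z => mkq (Im (d0 z)) (Im (d1 z)) (Im (d2 z)) (Im (d3 z))),
      (fun z => mkq (Re (d0 z)) (Re (d1 z)) (Re (d2 z)) (Re (d3 z))).
    split; [|split].
    + intros a b Hz.
      destruct (D0 _ Hz) as [P0 C0]. destruct (D1 _ Hz) as [P1 C1].
      destruct (D2 _ Hz) as [P2 C2]. destruct (D3 _ Hz) as [P3 C3].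
      apply partials_of_Cderiv in P0, P1, P2, P3.
      split; [apply is_derive_mkq; tauto|split; [apply is_derive_mkq; tauto|split]];
      apply continuous_quat; pcont.
    + intros a b Hz.
      destruct (D0 _ Hz) as [P0 C0]. destruct (D1 _ Hz) as [P1 C1].
      destruct (D2 _ Hz) as [P2 C2]. destruct (D3 _ Hz) as [P3 C3].
      apply partials_of_Cderiv in P0, P1, P2, P3.
      split; [apply is_derive_mkq; tauto|split; [apply is_derive_mkq; tauto|split]];
      apply continuous_quat; pcont.
    + intros z Hz. split; [reflexivity|].
      generalize (d0 z), (d1 z), (d2 z), (d3 z). quat_ring.
Qed.

(** At the real points, where [axis] makes an arbitrary choice, the odd part [G1]
    vanishes. *)
Lemma slice_regular_of_stem (Omega : quat -> Prop) (G0 G1 : R * R -> quat) :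
  circular_slice_domain Omega -> holomorphic_stem Omega G0 G1 ->
  exists g, slice_regular Omega g /\ induced Omega G0 G1 g.
Proof.
  intros HOm HG.
  exists (fun q => G0 (modulus_pt q) + axis q * G1 (modulus_pt q))%Q.
  enough (Hind : induced Omega G0 G1 (fun q => G0 (modulus_pt q) + axis q * G1 (modulus_pt q))%Q).
  { split; [exists G0, G1; split|]; assumption. }
  intros J a b HJ Hq.
  assert (Hz : stem_dom Omega (a, b)) by (exists J; auto).
  destruct HG as (Hsym & _). destruct (Hsym a b Hz) as [S0 S1].
  assert (Hm : modulus_pt (slice_pt J a b) = (a, Rabs b)).
  { unfold modulus_pt. destruct (slice_pt_coord J a b HJ) as [-> ->].
    rewrite qnorm_scal_unit by exact HJ. reflexivity. }
  assert (Hax : b <> 0 -> axis (slice_pt J a b) = qscal (/ Rabs b * b) J).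
  { intros Hb. unfold axis. destruct (slice_pt_coord J a b HJ) as [_ ->].
    rewrite qnorm_scal_unit by exact HJ.
    destruct (Req_EM_T (Rabs b) 0) as [E|_].
    - exfalso. revert E. apply Rabs_no_R0, Hb.
    - generalize (/ Rabs b). quat_ring. }
  rewrite Hm. destruct (Rtotal_order b 0) as [Hb|[Hb|Hb]].
  - rewrite Hax, Rabs_left, S0, S1 by lra.
    replace (/ - b * b) with (-1) by (field; lra).
    generalize (G0 (a, b)), (G1 (a, b)). quat_ring.
  - subst b. rewrite Rabs_R0. rewrite Ropp_0 in S1.
    assert (E : G1 (a, 0) = qreal 0).
    { destruct (G1 (a, 0)) as [[[x y] z] t]. qunf. injection S1 as X Y Z T.
      pair_eq; lra. }
    rewrite E. generalize (G0 (a, 0)), (axis (slice_pt J a 0)). quat_ring.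
  - rewrite Hax, Rabs_pos_eq by lra. rewrite Rinv_l by lra.
    generalize (G0 (a, b)), (G1 (a, b)). quat_ring.
Qed.

(** * Slice regular functions through their complex components *)

(** Commutation with complex conjugation is the even-odd symmetry of stems. *)
Definition real_hol (D : C -> Prop) (g : C -> C) : Prop :=
  hol D g /\ forall z, D z -> g (Cconj z) = Cconj (g z).

Definition has_components (Omega : quat -> Prop) (f : quat -> quat)
    (x0 x1 x2 x3 : C -> C) : Prop :=
  forall z, stem_dom Omega z -> forall J, imag_unit J ->
    f (slice_pt J (Re z) (Im z)) = stem_of (x0 z) (x1 z) (x2 z) (x3 z) J.

Lemma C_surj (c : C) : (Re c, Im c) = c.
Proof. destruct c; reflexivity. Qed.

Lemma exp_star_components (f : quat -> quat) (x0 x1 x2 x3 : C) (a b : R) :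
  (forall J, imag_unit J -> f (slice_pt J a b) = stem_of x0 x1 x2 x3 J) ->
  exists c s : C,
    (c * c + (x1 * x1 + x2 * x2 + x3 * x3) * (s * s) = 1)%C /\
    ((x1 * x1 + x2 * x2 + x3 * x3)%C = 0 -> c = 1) /\
    (Cmod (x1 * x1 + x2 * x2 + x3 * x3) < 1 -> s <> 0) /\
    forall J, imag_unit J -> exp_star f (slice_pt J a b)
      = stem_of (Cexp x0 * c) (Cexp x0 * s * x1) (Cexp x0 * s * x2) (Cexp x0 * s * x3) J.
Proof.
  intros H. unfold stem_of at 1 in H.
  destruct (exp_star_slice f _ _ a b H) as (c & s & H1 & H2 & H3 & H4).
  unfold vnorm, stem_coord, mkq, q_re, q_i, q_j, q_k in H1, H2, H3. cbn [fst snd] in H1, H2, H3.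
  rewrite !C_surj in H1, H2, H3.
  exists c, s. repeat split; try assumption.
  intros J HJ. rewrite (H4 J HJ), exp_star_stem_of by exact HJ.
  unfold stem_coord, mkq, q_re, q_i, q_j, q_k. cbn [fst snd]. rewrite !C_surj. reflexivity.
Qed.

Lemma slice_regular_components (Omega : quat -> Prop) (f : quat -> quat) :
  circular_slice_domain Omega -> slice_regular Omega f ->
  exists x0 x1 x2 x3 : C -> C,
    (real_hol (stem_dom Omega) x0 /\ real_hol (stem_dom Omega) x1 /\
     real_hol (stem_dom Omega) x2 /\ real_hol (stem_dom Omega) x3) /\
    has_components Omega f x0 x1 x2 x3.
Proof.
  intros HOm (F0 & F1 & HF & Hind).
  assert (Hp : forall p : quat -> R, is_linear p ->
    real_hol (stem_dom Omega) (fun z => stem_coord p (F0 z) (F1 z))).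
  { intros p Hp. split; [apply hol_stem_coord; assumption|].
    apply (stem_coord_conj Omega); assumption. }
  do 4 eexists. split.
  - split; [apply (Hp q_re), is_linear_q_re|]. split; [apply (Hp q_i), is_linear_q_i|].
    split; [apply (Hp q_j), is_linear_q_j|apply (Hp q_k), is_linear_q_k].
  - intros z Hz J HJ. rewrite (Hind J _ _ HJ) by (apply (stem_dom_slice Omega HOm); assumption).
    rewrite C_surj. apply stem_of_stem_coord.
Qed.

Lemma slice_regular_of_components (Omega : quat -> Prop) (x0 x1 x2 x3 : C -> C) :
  circular_slice_domain Omega ->
  real_hol (stem_dom Omega) x0 -> real_hol (stem_dom Omega) x1 ->
  real_hol (stem_dom Omega) x2 -> real_hol (stem_dom Omega) x3 ->
  exists f, slice_regular Omega f /\ has_components Omega f x0 x1 x2 x3.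
Proof.
  intros HOm H0 H1 H2 H3.
  destruct (slice_regular_of_stem Omega
    (fun z => mkq (Re (x0 z)) (Re (x1 z)) (Re (x2 z)) (Re (x3 z)))
    (fun z => mkq (Im (x0 z)) (Im (x1 z)) (Im (x2 z)) (Im (x3 z))) HOm) as (f & Hf & Hind).
  - apply stem_of_hol; [exact HOm|]. intros g [->|[->|[->| ->]]]; assumption.
  - exists f. split; [exact Hf|]. intros z Hz J HJ.
    rewrite (Hind J _ _ HJ) by (apply (stem_dom_slice Omega HOm); assumption).
    rewrite C_surj. reflexivity.
Qed.

(** The values of [f] at [alpha + I beta] and [alpha - I beta] lie in the same plane;
    doing this for [I = qi] and [I = qj] leaves only the real components of the stem. *)
Lemma slice_preserving_component (Omega : quat -> Prop) (f : quat -> quat) :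
  circular_slice_domain Omega -> slice_preserving Omega f ->
  exists x : C -> C, real_hol (stem_dom Omega) x /\
    has_components Omega f x (fun _ => RtoC 0) (fun _ => RtoC 0) (fun _ => RtoC 0).
Proof.
  intros HOm (Hf & Hpres).
  destruct (slice_regular_components Omega f HOm Hf)
    as (x0 & x1 & x2 & x3 & (H0 & _) & Hc).
  exists x0. split; [exact H0|]. intros z Hz J HJ. rewrite (Hc z Hz J HJ).
  assert (Hin : forall I, imag_unit I -> exists a b,
    stem_of (x0 z) (x1 z) (x2 z) (x3 z) I = slice_pt I a b).
  { intros I HI. rewrite <- (Hc z Hz I HI). apply Hpres; [exact HI| |].
    - apply (stem_dom_slice Omega HOm); assumption.
    - exists (Re z), (Im z). reflexivity. }
  destruct (Hin _ imag_unit_qi) as (a1 & b1 & E1).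
  destruct (Hin _ (imag_unit_opp _ imag_unit_qi)) as (a2 & b2 & E2).
  destruct (Hin _ imag_unit_qj) as (a3 & b3 & E3).
  destruct (Hin _ (imag_unit_opp _ imag_unit_qj)) as (a4 & b4 & E4).
  clear - E1 E2 E3 E4.
  destruct (x0 z) as [u0 v0], (x1 z) as [u1 v1], (x2 z) as [u2 v2], (x3 z) as [u3 v3].
  unfold stem_of in *. destruct J as [[[j0 j1] j2] j3]. qunf.
  injection E1 as A0 A1 A2 A3. injection E2 as B0 B1 B2 B3.
  injection E3 as C0 C1 C2 C3. injection E4 as D0 D1 D2 D3.
  assert (u1 = 0) by lra. assert (v1 = 0) by lra. assert (u2 = 0) by lra.
  assert (v2 = 0) by lra. assert (u3 = 0) by lra. assert (v3 = 0) by lra.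
  subst. reflexivity.
Qed.

Lemma vector_part_components (Omega : quat -> Prop) (f fv : quat -> quat) :
  circular_slice_domain Omega -> vector_part Omega f fv ->
  exists x0 x1 x2 x3 : C -> C,
    (real_hol (stem_dom Omega) x0 /\ real_hol (stem_dom Omega) x1 /\
     real_hol (stem_dom Omega) x2 /\ real_hol (stem_dom Omega) x3) /\
    has_components Omega f x0 x1 x2 x3 /\
    has_components Omega fv (fun _ => RtoC 0) x1 x2 x3.
Proof.
  intros HOm (f0 & (f1 & f2 & f3 & P0 & P1 & P2 & P3 & Hf) & Hfv).
  destruct (slice_preserving_component Omega f0 HOm P0) as (x0 & R0 & C0).
  destruct (slice_preserving_component Omega f1 HOm P1) as (x1 & R1 & C1).
  destruct (slice_preserving_component Omega f2 HOm P2) as (x2 & R2 & C2).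
  destruct (slice_preserving_component Omega f3 HOm P3) as (x3 & R3 & C3).
  exists x0, x1, x2, x3. split; [auto|].
  assert (HF : has_components Omega f x0 x1 x2 x3).
  { intros z Hz J HJ.
    rewrite Hf by (apply (stem_dom_slice Omega HOm); assumption).
    rewrite (C0 z Hz J HJ), (C1 z Hz J HJ), (C2 z Hz J HJ), (C3 z Hz J HJ).
    generalize (x0 z), (x1 z), (x2 z), (x3 z). unfold stem_of. quat_ring. }
  split; [exact HF|]. intros z Hz J HJ.
  rewrite Hfv by (apply (stem_dom_slice Omega HOm); assumption).
  rewrite (HF z Hz J HJ), (C0 z Hz J HJ).
  generalize (x0 z), (x1 z), (x2 z), (x3 z). unfold stem_of. quat_ring.
Qed.

(** The moduli give equal real parts, and [exp] has period [2 PI] along the imaginary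
    axis, whence the difference of the imaginary parts is a multiple of [PI]. *)
Lemma Cexp_square_inj (u v : C) : (Cexp u * Cexp u = Cexp v * Cexp v)%C ->
  Re u = Re v /\ sin (Im u - Im v) = 0.
Proof.
  rewrite <- !Cexp_plus. destruct u as [a b], v as [c d].
  unfold Cexp, Re, Im; simpl. intros H. injection H as H1 H2.
  pose proof (sin2_cos2 (b + b)) as S1. pose proof (sin2_cos2 (d + d)) as S2.
  unfold Rsqr in *. pose proof (exp_pos (a + a)) as P1. pose proof (exp_pos (c + c)) as P2.
  set (X := exp (a + a)) in *. set (Y := exp (c + c)) in *.
  assert (Hsq : X * X = Y * Y).
  { transitivity (X * X * (sin (b + b) * sin (b + b) + cos (b + b) * cos (b + b)));
      [rewrite S1; ring|].
    transitivity (Y * Y * (sin (d + d) * sin (d + d) + cos (d + d) * cos (d + d)));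
      [|rewrite S2; ring].
    transitivity ((X * cos (b + b)) * (X * cos (b + b)) + (X * sin (b + b)) * (X * sin (b + b)));
      [ring|rewrite H1, H2; ring]. }
  assert (HXY : X = Y) by nra.
  rewrite HXY in H1, H2.
  assert (Hcos : cos (b + b) = cos (d + d)) by (apply Rmult_eq_reg_l with Y; lra).
  assert (Hsin : sin (b + b) = sin (d + d)) by (apply Rmult_eq_reg_l with Y; lra).
  split.
  - unfold X, Y in HXY. apply exp_inv in HXY. lra.
  - assert (Hc : cos ((b + b) - (d + d)) = 1).
    { rewrite cos_minus, Hcos, Hsin. lra. }
    replace ((b + b) - (d + d)) with (2 * (b - d)) in Hc by ring.
    rewrite cos_2a_sin in Hc.
    destruct (Rmult_integral (sin (b - d)) (sin (b - d))) as [E|E]; [lra|exact E|exact E].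
Qed.

Lemma exp_star_opp_components (Omega : quat -> Prop) (f h : quat -> quat)
    (x0 x1 x2 x3 y0 y1 y2 y3 : C -> C) :
  circular_slice_domain Omega ->
  has_components Omega f x0 x1 x2 x3 -> has_components Omega h y0 y1 y2 y3 ->
  (forall q, Omega q -> exp_star h q = qopp (exp_star f q)) ->
  forall z, stem_dom Omega z -> exists c s c' s' : C,
    let n := (x1 z * x1 z + x2 z * x2 z + x3 z * x3 z)%C in
    let n' := (y1 z * y1 z + y2 z * y2 z + y3 z * y3 z)%C in
    (c * c + n * (s * s) = 1)%C /\ (c' * c' + n' * (s' * s') = 1)%C /\
    (n = 0 -> c = 1) /\ (n' = 0 -> c' = 1) /\ (Cmod n < 1 -> s <> 0) /\
    (Cexp (y0 z) * c' = - (Cexp (x0 z) * c))%C /\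
    (Cexp (y0 z) * s' * y1 z = - (Cexp (x0 z) * s * x1 z))%C /\
    (Cexp (y0 z) * s' * y2 z = - (Cexp (x0 z) * s * x2 z))%C /\
    (Cexp (y0 z) * s' * y3 z = - (Cexp (x0 z) * s * x3 z))%C.
Proof.
  intros HOm Hf Hh Hexp z Hz.
  destruct (exp_star_components f _ _ _ _ _ _ (Hf z Hz)) as (c & s & A1 & A2 & A3 & A4).
  destruct (exp_star_components h _ _ _ _ _ _ (Hh z Hz)) as (c' & s' & B1 & B2 & B3 & B4).
  exists c, s, c', s'. cbv zeta.
  assert (E : forall J, imag_unit J ->
    stem_of (Cexp (y0 z) * c') (Cexp (y0 z) * s' * y1 z) (Cexp (y0 z) * s' * y2 z)
      (Cexp (y0 z) * s' * y3 z) J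
    = stem_of (- (Cexp (x0 z) * c)) (- (Cexp (x0 z) * s * x1 z))
       (- (Cexp (x0 z) * s * x2 z)) (- (Cexp (x0 z) * s * x3 z)) J).
  { intros J HJ. rewrite <- (B4 J HJ).
    rewrite Hexp by (apply (stem_dom_slice Omega HOm); assumption). rewrite (A4 J HJ).
    generalize (Cexp (x0 z) * c)%C, (Cexp (x0 z) * s * x1 z)%C,
      (Cexp (x0 z) * s * x2 z)%C, (Cexp (x0 z) * s * x3 z)%C.
    unfold stem_of. quat_ring. }
  apply stem_of_inj in E. destruct E as (E0 & E1 & E2 & E3).
  repeat (split; [assumption|]). assumption.
Qed.

(** The complex norm of [exp (x + v)] is [exp (2 x)] because [c * c + n * (s * s) = 1],
    and it does not see the sign.  So the two real parts differ by a multiple of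
    [PI * Ci], which is zero on the real axis and hence everywhere.  This is where a
    global hypothesis is indispensable: near a single point [f + PI * Ci] would give a
    logarithm of [- exp f]. *)
Lemma exp_star_opp_real_part (Omega : quat -> Prop) (f h : quat -> quat)
    (x0 x1 x2 x3 y0 y1 y2 y3 : C -> C) :
  circular_slice_domain Omega -> real_hol (stem_dom Omega) x0 -> real_hol (stem_dom Omega) y0 ->
  has_components Omega f x0 x1 x2 x3 -> has_components Omega h y0 y1 y2 y3 ->
  (forall q, Omega q -> exp_star h q = qopp (exp_star f q)) ->
  forall z, stem_dom Omega z -> y0 z = x0 z.
Proof.
  intros HOm (Hx & Sx) (Hy & Sy) Hf Hh Hexp.
  assert (Hsq : forall z, stem_dom Omega z ->
    Re (y0 z) = Re (x0 z) /\ sin (Im (y0 z) - Im (x0 z)) = 0).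
  { intros z Hz. apply Cexp_square_inj.
    destruct (exp_star_opp_components Omega f h _ _ _ _ _ _ _ _ HOm Hf Hh Hexp z Hz)
      as (c & s & c' & s' & A1 & A2 & _ & _ & _ & E0 & E1 & E2 & E3).
    set (ey := Cexp (y0 z)) in *. set (ex := Cexp (x0 z)) in *.
    transitivity (ey * ey * (c' * c' +
      (y1 z * y1 z + y2 z * y2 z + y3 z * y3 z) * (s' * s')))%C; [rewrite A2; ring|].
    transitivity (ex * ex * (c * c +
      (x1 z * x1 z + x2 z * x2 z + x3 z * x3 z) * (s * s)))%C; [|rewrite A1; ring].
    transitivity ((ey * c') * (ey * c') + (ey * s' * y1 z) * (ey * s' * y1 z)
      + (ey * s' * y2 z) * (ey * s' * y2 z) + (ey * s' * y3 z) * (ey * s' * y3 z))%C; [ring|].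
    rewrite E0, E1, E2, E3. ring. }
  intros z Hz. apply injective_projections; [apply Hsq, Hz|].
  pose proof (stem_dom_sin_zero Omega HOm (fun z => Im (y0 z) + - Im (x0 z))) as Hd.
  change (Im (y0 z) = Im (x0 z)).
  enough (Im (y0 z) + - Im (x0 z) = 0) by lra. apply Hd; [| | |exact Hz].
  - intros w Hw.
    pose proof (continuous_Im y0 w (hol_continuous _ _ _ Hy Hw)) as K1.
    pose proof (continuous_Im x0 w (hol_continuous _ _ _ Hx Hw)) as K2.
    exact (continuous_Rplus _ _ w K1 (continuous_Ropp _ w K2)).
  - intros w Hw. apply Hsq, Hw.
  - intros w Hw. rewrite Sx, Sy by exact Hw. unfold Im; simpl. ring.
Qed.

(** * Divisibility by Delta *)

Definition Cdelta (z0 z : C) : C := ((z - z0) * (z - Cconj z0))%C.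

Lemma Delta_slice (q0 J : quat) (z : C) : imag_unit J ->
  Defs.Delta q0 (slice_pt J (Re z) (Im z)) = in_plane J (Cdelta (modulus_pt q0) z).
Proof.
  intros HJ. unfold Defs.Delta. fold (in_plane J z). rewrite <- in_plane_mult by exact HJ.
  assert (En : qnorm2 q0 = q_re q0 ^ 2 + qnorm (qvec q0) ^ 2).
  { rewrite qnorm_sq. unfold qnorm2.
    destruct q0 as [[[a b] c] d]. qunf. ring. }
  rewrite En. unfold Cdelta, modulus_pt, in_plane.
  generalize (q_re q0), (qnorm (qvec q0)). quat_ring.
Qed.

Lemma qpow_in_plane J c m : imag_unit J -> qpow (in_plane J c) m = in_plane J (c ^ m)%C.
Proof.
  intros HJ. induction m as [|m IH]; simpl.
  - unfold in_plane. quat_ring.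
  - rewrite IH, in_plane_mult by exact HJ. reflexivity.
Qed.

Lemma Delta_factor_components (Omega : quat -> Prop) (f g : quat -> quat) (q0 : quat) (m : nat)
    (x0 x1 x2 x3 y0 y1 y2 y3 : C -> C) :
  circular_slice_domain Omega -> slice_regular Omega g ->
  has_components Omega f x0 x1 x2 x3 -> has_components Omega g y0 y1 y2 y3 ->
  Delta_factor Omega q0 f m g <->
  forall z, stem_dom Omega z ->
    let d := (Cdelta (modulus_pt q0) z ^ m)%C in
    x0 z = (d * y0 z)%C /\ x1 z = (d * y1 z)%C /\ x2 z = (d * y2 z)%C /\ x3 z = (d * y3 z)%C.
Proof.
  intros HOm Hg Hf Hy.
  assert (Hprod : forall z J, stem_dom Omega z -> imag_unit J ->
    (qpow (Defs.Delta q0 (slice_pt J (Re z) (Im z))) m * g (slice_pt J (Re z) (Im z)))%Q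
    = let d := (Cdelta (modulus_pt q0) z ^ m)%C in
      stem_of (d * y0 z) (d * y1 z) (d * y2 z) (d * y3 z) J).
  { intros z J Hz HJ. rewrite Delta_slice, qpow_in_plane, (Hy z Hz J HJ) by exact HJ.
    apply in_plane_stem_of, HJ. }
  split.
  - intros [_ H] z Hz. apply stem_of_inj. intros J HJ.
    rewrite <- (Hf z Hz J HJ), H by (apply (stem_dom_slice Omega HOm); assumption).
    apply Hprod; assumption.
  - intros H. split; [exact Hg|]. intros q Hq.
    destruct (axis_spec q) as [HJ Eq].
    assert (Hz : stem_dom Omega (modulus_pt q)) by (apply stem_dom_modulus, Hq).
    destruct (H _ Hz) as (E0 & E1 & E2 & E3).
    pose proof (Hf _ Hz _ HJ) as Ef. pose proof (Hprod _ _ Hz HJ) as Ep.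
    unfold modulus_pt in Ef, Ep at 1 2 3 4. unfold Re, Im in Ef, Ep; cbn [fst snd] in Ef, Ep.
    rewrite <- Eq in Ef, Ep. rewrite Ef. rewrite Ep.
    fold (modulus_pt q). rewrite E0, E1, E2, E3. reflexivity.
Qed.

(** The zero [z0] comes with the zero [Cconj z0], so both linear factors of [Cdelta z0]
    can be divided out.  The quotient inherits the symmetry under conjugation where
    [Cdelta z0] is nonzero, and by continuity at its two zeros. *)
Lemma real_hol_divide (Omega : quat -> Prop) (g : C -> C) (z0 : C) :
  circular_slice_domain Omega -> real_hol (stem_dom Omega) g ->
  stem_dom Omega z0 -> Im z0 <> 0 -> g z0 = 0 ->
  exists k, real_hol (stem_dom Omega) k /\
    forall z, stem_dom Omega z -> g z = (Cdelta z0 z * k z)%C.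
Proof.
  intros HOm (Hg & Sg) Hz0 Him Hg0.
  set (D := stem_dom Omega : C -> Prop) in *.
  assert (HO : open D) by apply (stem_dom_open Omega HOm).
  assert (HDc : forall z, D z -> D (Cconj z)) by apply (stem_dom_conj Omega HOm).
  destruct (hol_divide D g z0 HO Hg Hz0 Hg0) as (k1 & Hk1 & E1).
  assert (Hne : (Cconj z0 - z0)%C <> 0).
  { intros E. apply (f_equal Im) in E. unfold Cconj, Im in *; simpl in E. lra. }
  assert (Hk10 : k1 (Cconj z0) = 0).
  { assert (E : ((Cconj z0 - z0) * k1 (Cconj z0))%C = 0).
    { rewrite <- E1 by (apply HDc, Hz0). rewrite Sg, Hg0 by exact Hz0.
      apply injective_projections; simpl; ring. }
    destruct (Ceq_dec (k1 (Cconj z0)) 0) as [|Hn]; [assumption|].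
    exfalso. apply (Cmult_neq_0 _ _ Hne Hn E). }
  destruct (hol_divide D k1 (Cconj z0) HO Hk1 (HDc _ Hz0) Hk10) as (k & Hk & E2).
  assert (E : forall z, D z -> g z = (Cdelta z0 z * k z)%C).
  { intros z Hz. rewrite E1, E2 by exact Hz. unfold Cdelta. ring. }
  exists k. split; [split; [exact Hk|]|exact E].
  assert (Hdc : forall z, Cdelta z0 (Cconj z) = Cconj (Cdelta z0 z)).
  { intros z. unfold Cdelta. rewrite Cmult_conj, !Cminus_conj, Cconj_conj. ring. }
  assert (Hgen : forall z, D z -> Cdelta z0 z <> 0 -> k (Cconj z) = Cconj (k z)).
  { intros z Hz Hd.
    assert (Hd' : Cdelta z0 (Cconj z) <> 0).
    { rewrite Hdc. intros E0. apply Hd. rewrite <- (Cconj_conj (Cdelta z0 z)), E0.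
      apply injective_projections; simpl; ring. }
    assert (Ez : (Cdelta z0 (Cconj z) * k (Cconj z)
                 = Cdelta z0 (Cconj z) * Cconj (k z))%C).
    { rewrite <- E by (apply HDc, Hz). rewrite Sg, E, Cmult_conj, Hdc by exact Hz. reflexivity. }
    transitivity (/ Cdelta z0 (Cconj z) * (Cdelta z0 (Cconj z) * k (Cconj z)))%C;
      [field; exact Hd'|]. rewrite Ez. field. exact Hd'. }
  intros z Hz. destruct (Ceq_dec (Cdelta z0 z) 0) as [Hd|Hd]; [|apply Hgen; assumption].
  (* [z] is one of the two zeros of [Cdelta z0]; nearby points are not zeros. *)
  apply (limit_unique (fun w => k (Cconj w)) (fun w => Cconj (k w))).
  - apply (continuous_comp Cconj k).
    + apply (continuous_Cconj (fun w => w)), continuous_id.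
    + apply hol_continuous with (1 := Hk), HDc, Hz.
  - apply continuous_Cconj. apply hol_continuous with (1 := Hk), Hz.
  - assert (Hzz : z = z0 \/ z = Cconj z0).
    { destruct (Ceq_dec z z0) as [|N1]; [left; assumption|right].
      destruct (Ceq_dec z (Cconj z0)) as [|N2]; [assumption|exfalso].
      revert Hd. apply Cmult_neq_0; intros E0; [apply N1|apply N2]; apply Ceq_minus, E0. }
    assert (Hzc : z <> Cconj z).
    { intros E0. apply Him. apply (f_equal Im) in E0.
      destruct Hzz as [-> | ->]; unfold Cconj, Im in *; simpl in E0; lra. }
    pose proof (locally_neq (fun w => w) z (Cconj z) (continuous_id z) Hzc) as HL.
    generalize (filter_and _ _ HL (HO z Hz)). apply filter_imp.
    intros w [W1 W2] W3. apply Hgen; [exact W2|].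
    unfold Cdelta. apply Cmult_neq_0; intros E0; apply Ceq_minus in E0; subst w;
    destruct Hzz as [-> | ->]; try rewrite Cconj_conj in *; congruence.
Qed.

(** * Isolated zeros and logarithms *)

(** If [G0 + J G1 = 0] then [G0 = - J G1] has the same length as [G1] and is orthogonal
    to it, since multiplication by [J] is a rotation by a right angle.  So a zero on a
    single slice makes the complex sum of squares vanish. *)
Lemma isotropic_of_zero (c0 c1 c2 c3 : C) (J : quat) : imag_unit J ->
  stem_of c0 c1 c2 c3 J = qreal 0 ->
  (c0 * c0 + c1 * c1 + c2 * c2 + c3 * c3)%C = 0.
Proof.
  intros HJ H. apply imag_unit_coord in HJ. destruct HJ as [H0 H1].
  destruct c0 as [u0 v0], c1 as [u1 v1], c2 as [u2 v2], c3 as [u3 v3].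
  destruct J as [[[j0 j] k] l]. unfold stem_of in H. qunf. subst j0.
  injection H as E0 E1 E2 E3.
  assert (U0 : u0 = j * v1 + k * v2 + l * v3) by lra.
  assert (U1 : u1 = - (j * v0 + k * v3 - l * v2)) by lra.
  assert (U2 : u2 = - (- j * v3 + k * v0 + l * v1)) by lra.
  assert (U3 : u3 = - (j * v2 - k * v1 + l * v0)) by lra.
  apply injective_projections; simpl.
  - transitivity ((j * (j * 1) + k * (k * 1) + l * (l * 1) - 1)
      * (v0 * v0 + v1 * v1 + v2 * v2 + v3 * v3)); [rewrite U0, U1, U2, U3; ring|].
    replace (j * (j * 1) + k * (k * 1) + l * (l * 1) - 1) with 0 by lra. ring.
  - rewrite U0, U1, U2, U3. ring.
Qed.

Lemma modulus_pt_nonreal (q : quat) : ~ is_real q -> Im (modulus_pt q) > 0.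
Proof.
  intros H. unfold modulus_pt, Im; simpl.
  destruct (Rle_lt_or_eq_dec _ _ (qnorm_pos (qvec q))) as [Hp|E]; [exact Hp|exfalso].
  apply H. exists (q_re q). destruct (axis_spec q) as [_ Eq]. rewrite <- E in Eq.
  rewrite Eq at 1. generalize (axis q), (q_re q). quat_ring.
Qed.

Lemma Cdelta_neq_0_near (z0 : C) : Im z0 > 0 ->
  locally z0 (fun z => z <> z0 -> Cdelta z0 z <> 0).
Proof.
  intros H. assert (Hn : z0 <> Cconj z0).
  { intros E. apply (f_equal Im) in E. unfold Cconj, Im in *; simpl in *. lra. }
  generalize (locally_neq (fun w => w) z0 (Cconj z0) (continuous_id z0) Hn).
  apply filter_imp. intros z H1 H2. unfold Cdelta.
  apply Cmult_neq_0; intros E; apply Ceq_minus in E; congruence.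
Qed.

Theorem corollary6p7 (Omega : quat -> Prop) (f fv : quat -> quat)
    (hOmega : circular_slice_domain Omega)
    (hf : slice_regular Omega f)
    (hfv : vector_part Omega f fv)
    (hzero : exists q0 : quat, nonreal_isolated_zero Omega fv q0) :
  ~ exists h : quat -> quat,
      slice_regular Omega h /\
      forall q : quat, Omega q -> exp_star h q = qopp (exp_star f q).
Proof.
  intros (h & Hh & Hexp).
  destruct hzero as (q0 & Hq0 & Hnr & _ & m & g & Hfac & Hmax & Hg0).
  destruct (vector_part_components Omega f fv hOmega hfv)
    as (x0 & x1 & x2 & x3 & (Rx0 & Rx1 & Rx2 & Rx3) & Cf & Cfv).
  destruct (slice_regular_components Omega h hOmega Hh)
    as (y0 & y1 & y2 & y3 & (Ry0 & Ry1 & Ry2 & Ry3) & Ch).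
  assert (Hgreg : slice_regular Omega g) by apply Hfac.
  destruct (slice_regular_components Omega g hOmega Hgreg)
    as (g0 & g1 & g2 & g3 & (Rg0 & Rg1 & Rg2 & Rg3) & Cg).
  pose proof (proj1 (Delta_factor_components Omega fv g q0 m _ _ _ _ _ _ _ _ hOmega Hgreg Cfv Cg)
    Hfac) as Hdiv. cbv zeta beta in Hdiv.
  pose proof (exp_star_opp_real_part Omega f h _ _ _ _ _ _ _ _ hOmega Rx0 Ry0 Cf Ch Hexp) as Hreal.
  set (D := stem_dom Omega : C -> Prop) in *.
  set (z0 := modulus_pt q0 : C) in *.
  assert (Hz0 : D z0) by (apply stem_dom_modulus, Hq0).
  assert (Him : Im z0 > 0) by (apply modulus_pt_nonreal, Hnr).
  assert (HO : open D) by apply (stem_dom_open Omega hOmega).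
  assert (Hcont : forall x, real_hol D x -> continuous x z0).
  { intros x (Hx & _). apply hol_continuous with (1 := Hx), Hz0. }
  pose proof (Hcont _ Rx1) as Kx1. pose proof (Hcont _ Rx2) as Kx2. pose proof (Hcont _ Rx3) as Kx3.
  pose proof (Hcont _ Ry1) as Ky1. pose proof (Hcont _ Ry2) as Ky2. pose proof (Hcont _ Ry3) as Ky3.
  pose proof (Hcont _ Rg0) as Kg0.
  pose proof (Hcont _ Rg1) as Kg1. pose proof (Hcont _ Rg2) as Kg2. pose proof (Hcont _ Rg3) as Kg3.
  set (n := fun z => (x1 z * x1 z + x2 z * x2 z + x3 z * x3 z)%C).
  set (n' := fun z => (y1 z * y1 z + y2 z * y2 z + y3 z * y3 z)%C).
  set (ng := fun z => (g1 z * g1 z + g2 z * g2 z + g3 z * g3 z)%C).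
  assert (Hd0 : locally z0 (fun z => z <> z0 -> (Cdelta z0 z ^ m)%C <> 0)).
  { generalize (Cdelta_neq_0_near z0 Him). apply filter_imp.
    intros z Hz Hne. apply Cpow_nz, Hz, Hne. }
  (* [fv] has no real part, so [g0] vanishes wherever [Cdelta z0] does not. *)
  assert (G0 : g0 z0 = 0).
  { apply (limit_unique g0 (fun _ => RtoC 0)); [exact Kg0|apply continuous_const|].
    generalize (filter_and _ _ Hd0 (HO z0 Hz0)). apply filter_imp.
    intros z [Hd Hz] Hne. destruct (Hdiv z Hz) as (E & _).
    destruct (Ceq_dec (g0 z) 0) as [|Hn]; [assumption|].
    exfalso. apply (Cmult_neq_0 _ _ (Hd Hne) Hn). symmetry. exact E. }
  assert (Hng : ng z0 = 0).
  { destruct (axis_spec q0) as [HJ Eq].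
    assert (E : g q0 = stem_of (g0 z0) (g1 z0) (g2 z0) (g3 z0) (axis q0)).
    { rewrite Eq at 1. exact (Cg z0 Hz0 _ HJ). }
    rewrite Hg0 in E. symmetry in E. apply isotropic_of_zero in E; [|exact HJ].
    rewrite G0 in E. unfold ng. rewrite <- E. ring. }
  assert (Hn : forall z, D z -> n z = (Cdelta z0 z ^ m * Cdelta z0 z ^ m * ng z)%C).
  { intros z Hz. destruct (Hdiv z Hz) as (_ & E1 & E2 & E3).
    unfold n, ng. rewrite E1, E2, E3. ring. }
  assert (Hn0 : n z0 = 0) by (rewrite Hn, Hng by exact Hz0; ring).
  (* At [z0] the coefficient [c] is 1 for [f], hence [c'] is -1 for [h], which excludes
     [n' z0 = 0]. *)
  assert (Hn' : n' z0 <> 0).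
  { intros E. destruct (exp_star_opp_components Omega f h _ _ _ _ _ _ _ _ hOmega Cf Ch Hexp z0 Hz0)
      as (c & s & c' & s' & _ & _ & Hc & Hc' & _ & E0 & _).
    fold (n z0) in Hc. fold (n' z0) in Hc'.
    rewrite (Hc Hn0), (Hc' E), (Hreal z0 Hz0) in E0.
    apply (Cexp_neq_0 (x0 z0)). set (e := Cexp (x0 z0)) in *.
    assert (E2 : (RtoC 2 * e = 0)%C).
    { transitivity (e * 1 + e * 1)%C; [ring|]. rewrite E0 at 1. ring. }
    destruct (Ceq_dec e 0) as [|He]; [assumption|exfalso].
    apply (Cmult_neq_0 (RtoC 2) e); [|exact He|exact E2].
    intros E3. apply RtoC_inj in E3. lra. }
  assert (Hnsmall : locally z0 (fun z => Cmod (n z) < 1)).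
  { assert (Kn : continuous n z0) by (unfold n; ccont).
    destruct (proj1 (continuous_disc n z0) Kn 1 Rlt_0_1) as (r & Hr & H).
    apply locally_disc. exists r. split; [exact Hr|]. intros w Hw.
    specialize (H w Hw). rewrite Hn0 in H.
    replace (n w - 0)%C with (n w) in H by ring. exact H. }
  (* Where [xl = k * yl] for all three components, [xl * xl * n' = yl * yl * n].  Both
     sides contain the square of [Cdelta z0 ^ m], which cancels off [z0]; at [z0] what
     remains of the right-hand side vanishes with [ng], while [n'] does not vanish. *)
  assert (Hrel : forall (gl yl xl : C -> C),
    continuous gl z0 -> continuous yl z0 ->
    (forall z, D z -> xl z = (Cdelta z0 z ^ m * gl z)%C) ->
    locally z0 (fun z => exists k, xl z = (k * yl z)%C /\ n z = (k * k * n' z)%C) ->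
    gl z0 = 0).
  { intros gl yl xl Kg Ky Exl Hk.
    assert (E : (gl z0 * gl z0 * n' z0 = yl z0 * yl z0 * ng z0)%C).
    { apply (limit_unique (fun z => gl z * gl z * n' z)%C (fun z => yl z * yl z * ng z)%C);
        [unfold n'; ccont|unfold ng; ccont|].
      generalize (filter_and _ _ Hk (filter_and _ _ Hd0 (HO z0 Hz0))). apply filter_imp.
      intros z [(k & K1 & K2) [Hd Hz]] Hne. specialize (Hd Hne).
      set (d := (Cdelta z0 z ^ m)%C) in *.
      assert (E : (d * d * (gl z * gl z * n' z) = d * d * (yl z * yl z * ng z))%C).
      { transitivity (xl z * xl z * n' z)%C; [rewrite Exl by exact Hz; fold d; ring|].
        rewrite K1. transitivity (yl z * yl z * (k * k * n' z))%C; [ring|].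
        rewrite <- K2, Hn by exact Hz. fold d. ring. }
      transitivity (/ d * / d * (d * d * (gl z * gl z * n' z)))%C; [field; exact Hd|].
      rewrite E. field. exact Hd. }
    rewrite Hng in E. destruct (Ceq_dec (gl z0) 0) as [|Hgl]; [assumption|exfalso].
    apply (Cmult_neq_0 _ _ (Cmult_neq_0 _ _ Hgl Hgl) Hn').
    rewrite E. ring. }
  (* Near [z0] the coefficient [s] is nonzero, so the vector part of [f] is a complex
     multiple of that of [h]. *)
  assert (Hprop : locally z0 (fun z => exists k : C,
    x1 z = (k * y1 z)%C /\ x2 z = (k * y2 z)%C /\ x3 z = (k * y3 z)%C)).
  { generalize (filter_and _ _ Hnsmall (HO z0 Hz0)). apply filter_imp. intros z [Hsm Hz].
    destruct (exp_star_opp_components Omega f h _ _ _ _ _ _ _ _ hOmega Cf Ch Hexp z Hz)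
      as (c & s & c' & s' & _ & _ & _ & _ & Hs & _ & E1 & E2 & E3).
    specialize (Hs Hsm). rewrite (Hreal z Hz) in E1, E2, E3.
    pose proof (Cexp_neq_0 (x0 z)) as He. set (e := Cexp (x0 z)) in *.
    assert (Hl : forall x y : C, (e * s' * y = - (e * s * x))%C -> x = (- (s' / s) * y)%C).
    { intros x y E. transitivity (- / (e * s) * - (e * s * x))%C;
        [field; split; assumption|]. rewrite <- E. field. split; assumption. }
    exists (- (s' / s))%C. auto. }
  assert (Hscal : forall z k, x1 z = (k * y1 z)%C -> x2 z = (k * y2 z)%C ->
    x3 z = (k * y3 z)%C -> n z = (k * k * n' z)%C).
  { intros z k E1 E2 E3. unfold n, n'. rewrite E1, E2, E3. ring. }
  assert (G1 : g1 z0 = 0).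
  { apply (Hrel g1 y1 x1 Kg1 Ky1); [intros z Hz; apply Hdiv, Hz|].
    revert Hprop. apply filter_imp. intros z (k & E1 & E2 & E3). exists k. auto. }
  assert (G2 : g2 z0 = 0).
  { apply (Hrel g2 y2 x2 Kg2 Ky2); [intros z Hz; apply Hdiv, Hz|].
    revert Hprop. apply filter_imp. intros z (k & E1 & E2 & E3). exists k. auto. }
  assert (G3 : g3 z0 = 0).
  { apply (Hrel g3 y3 x3 Kg3 Ky3); [intros z Hz; apply Hdiv, Hz|].
    revert Hprop. apply filter_imp. intros z (k & E1 & E2 & E3). exists k. auto. }
  assert (Him' : Im z0 <> 0) by lra.
  destruct (real_hol_divide Omega g0 z0 hOmega Rg0 Hz0 Him' G0) as (k0 & Rk0 & D0).
  destruct (real_hol_divide Omega g1 z0 hOmega Rg1 Hz0 Him' G1) as (k1 & Rk1 & D1).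
  destruct (real_hol_divide Omega g2 z0 hOmega Rg2 Hz0 Him' G2) as (k2 & Rk2 & D2).
  destruct (real_hol_divide Omega g3 z0 hOmega Rg3 Hz0 Him' G3) as (k3 & Rk3 & D3).
  destruct (slice_regular_of_components Omega k0 k1 k2 k3 hOmega Rk0 Rk1 Rk2 Rk3)
    as (k & Hk & Ck).
  assert (Hfac' : Delta_factor Omega q0 fv (S m) k).
  { apply (Delta_factor_components Omega fv k q0 (S m) _ _ _ _ _ _ _ _ hOmega Hk Cfv Ck).
    intros z Hz. cbv zeta. fold z0. destruct (Hdiv z Hz) as (E0 & E1 & E2 & E3).
    rewrite E0, E1, E2, E3, D0, D1, D2, D3, Cpow_S by exact Hz. repeat split; ring. }
  specialize (Hmax _ _ Hfac'). lia.
Qed.
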